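(* For each filtered space $X$ endowed with two perversities $\overline p$ and $\overline q$, there exists an associative multiplication $$-\cup-\colon\widetilde N^k_{\overline p}(X;R)\otimes\widetilde N^\ell_{\overline q}(X;R)\to\widetilde N^{k+\ell}_{\overline p+\overline q}(X;R),$$ defined by $(\omega\cup\eta)_\sigma=\omega_\sigma\cup\eta_\sigma$ for each pair of cochains $(\omega,\eta)\in\widetilde N^k_{\overline p}(X;R)\times\widetilde N^\ell_{\overline q}(X;R)$ and each regular simplex $\sigma\colon\Delta\to X$. It induces a graded commutative multiplication with unity, called intersection cup product, $$-\cup-\colon\mathscr H^k_{\overline p}(X;R)\otimes\mathscr H^\ell_{\overline q}(X;R)\to\mathscr H^{k+\ell}_{\overline p+\overline q}(X;R).$$
   Context: $R$ is a commutative ring with unity. Filtered spaces. A filtered space is a Hausdorff space $X$ with a filtration by closed subspaces $\emptyset=X_{-1}\subseteq X_0\subseteq\dots\subseteq X_{n-1}\subsetneq X_n=X$; $n=\dim X$ is the formal dimension. Strata are the non-empty connected components of the $X_i\setminus X_{i-1}$; a stratum $S\subset X_i\setminus X_{i-1}$ has $\operatorname{codim}S=n-i$; it is regular if $\operatorname{codim}S=0$, singular otherwise. A perversity on $X$ is a map $\overline p$ from the set of strata to $\mathbb Z\cup\{\pm\infty\}$ with value $0$ on regular strata. $(\overline p+\overline q)(S)=\overline p(S)+\overline q(S)$, with the convention that the sum is $-\infty$ if one of the terms is $-\infty$. Filtered simplices. A filtered singular simplex is a continuous map $\sigma\colon\Delta\to X$ from a euclidean simplex (with ordered vertices) with a join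 decomposition $\Delta=\Delta_0*\dots*\Delta_n$ (some $\Delta_i$ may be empty), compatible with the vertex order, such that $\sigma^{-1}(X_i)=\Delta_0*\dots*\Delta_i$ for all $i$. It is regular if $\Delta_n\neq\emptyset$. A regular face operator is the inclusion $\delta_\ell\colon\nabla\to\Delta$ of a codimension-one face with $\nabla_i=\nabla\cap\Delta_i$ and $\nabla_n\ne\emptyset$. Blow-up. For an ordered simplicial complex $K$, $N_*(K)$ is its simplicial chain complex over $R$, $N^*(K)=\operatorname{Hom}(N_*(K),R)$ with $(\delta f)(v)=-(-1)^{|f|}f(\partial v)$, and $\mathbf 1_F$ is the cochain equal to $1$ on the simplex $F$ and $0$ on the others. For a simplex $E$, $\mathtt cE=E*[\mathtt v]$ is the cone with apex $\mathtt v$ as last vertex ($\mathtt c\emptyset=[\mathtt v]$); its faces are written $(F,0)=F$ ($\emptyset\ne F$ a face of $E$) and $(F,1)=F*[\mathtt v]$ ($F$ a possibly empty face of $E$). Put $|(F,\varepsilon)|=\dim F+\varepsilon$, with $|(\emptyset,1)|=0$. For a regular simplex $\Delta$ put $\widetilde N^*(\Delta)=N^*(\mathtt c\Delta_0)\otimes\dots\otimes N^*(\mathtt c\Delta_{n-1})\otimes N^*(\Delta_n)$ with the tensor product differential and basis $\mathbf 1_{(F,\varepsilon)}=\mathbf 1_{(F_0,\varepsilon_0)}\otimes\dots\otimes\mathbf 1_{(F_{n-1},\varepsilon_{n-1})}\otimes\mathbf 1_{F_n}$ ($\varepsilon_n=0$, $F_n\neq\emptyset$). For $\ell\in\{1,\dots,n\}$,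 $\|\mathbf 1_{(F,\varepsilon)}\|_\ell=-\infty$ if $\varepsilon_{n-\ell}=1$ and $=\sum_{i>n-\ell}|(F_i,\varepsilon_i)|$ if $\varepsilon_{n-\ell}=0$; for a linear combination with non-zero coefficients take the maximum; $\|0\|_\ell=-\infty$. $\widetilde N^*(X;R)$ is the complex of families $\omega=(\omega_\sigma)_\sigma$ indexed by regular simplices $\sigma\colon\Delta\to X$, $\omega_\sigma\in\widetilde N^*(\Delta)$, with $\delta_\ell^*\omega_\sigma=\omega_{\sigma\circ\delta_\ell}$ for every regular face operator; $(\delta\omega)_\sigma=\delta(\omega_\sigma)$. For a singular stratum $S$, $\|\omega\|_S=\sup\{\|\omega_\sigma\|_{\operatorname{codim}S}: \sigma\text{ regular},\ \operatorname{im}\sigma\cap S\neq\emptyset\}$. $\omega$ is $\overline p$-allowable if $\|\omega\|_S\le\overline p(S)$ for all singular $S$. $\widetilde N^*_{\overline p}(X;R)$ is the complex of $\omega$ with $\omega,\delta\omega$ both $\overline p$-allowable; its cohomology is the blown-up intersection cohomology $\mathscr H^*_{\overline p}(X;R)$. Local cup product. Ordered simplices $F=[a_0,\dots,a_k]$, $G=[b_0,\dots,b_\ell]$ of a simplex are compatible if $a_k=b_0$, and then $F\cup G=[a_0,\dots,a_k,b_1,\dots,b_\ell]$. On $N^*(\Delta)$: $\mathbf 1_F\cup\mathbf 1_G=(-1)^{k\ell}\mathbf 1_{F\cup G}$ if compatible, $0$ otherwise. On the cone $\mathtt cE$ (same rule): $\mathbf 1_{(F,\varepsilon)}\cup\mathbf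 1_{(G,\kappa)}=(-1)^{|F||(G,\kappa)|}\mathbf 1_{(F\cup G,\kappa)}$ if $\varepsilon=0$ and $F,G$ compatible; $=\mathbf 1_{(F,\varepsilon)}$ if $\varepsilon=1$ and $(G,\kappa)=(\emptyset,1)$; $0$ otherwise. On $\widetilde N^*(\Delta)$: $(\omega_0\otimes\dots\otimes\omega_n)\cup(\eta_0\otimes\dots\otimes\eta_n)=(-1)^{\sum_{i>j}|\omega_i||\eta_j|}(\omega_0\cup\eta_0)\otimes\dots\otimes(\omega_n\cup\eta_n)$. *)

(* Defs.v *)
From HB Require Import structures.
From mathcomp Require Import all_boot all_order all_algebra.
From mathcomp Require Import all_classical all_reals.
From mathcomp Require Import topology normedtype.

Set Implicit Arguments.
Unset Strict Implicit.
Unset Printing Implicit Defensive.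

Import Order.TTheory GRing.Theory Num.Theory.
Import numFieldNormedType.Exports.

Local Open Scope classical_set_scope.
Local Open Scope ring_scope.

Section OrderedSimplex.
Local Open Scope set_scope.
Variables (R : comPzRingType) (k : nat) (A : {set 'I_k}).

(* The simplices of the full simplicial complex on the ordered vertex set A. *)
Definition face : Type := {F : {set 'I_k} | (0 < #|F|)%N && (F \subset A)}.

HB.instance Definition _ := SubFinite.on face.

Definition vertices (F : face) : {set 'I_k} := \val F.

Definition fdeg (F : face) : nat := #|vertices F|.-1.

(* N_*(A) and N^*(A); a cochain is given by its values on the simplices. *)
Definition chain : Type := {ffun face -> R^o}.
Definition cochain : Type := {ffun face -> R^o}.

Definition simplex_boundary (F : face) : chain :=
  [ffun G => \sum_(v in vertices F | vertices G == vertices F :\ v)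
     (-1) ^+ #|[set u in vertices F | (u < v)%N]|].

(* The coboundary -(-1)^|f| f o d, extended to non-homogeneous cochains: the
   values of f on simplices of dimension d form its component of degree d. *)
Definition coboundary (f : cochain) : cochain :=
  [ffun F => - \sum_G (-1) ^+ fdeg G * (simplex_boundary F G * f G)].

Definition indic (F : face) : cochain := [ffun G => (G == F)%:R].

Definition compatible (F G : face) : bool :=
  [exists v in vertices F :&: vertices G,
    [forall u in vertices F, (u <= v)%N] &&
    [forall u in vertices G, (v <= u)%N]].

Definition cup_indic (F G : face) : cochain :=
  [ffun H => if compatible F G && (vertices H == vertices F :|: vertices G)
             then (-1) ^+ (fdeg F * fdeg G) else 0].

End OrderedSimplex.

Arguments face {k} A.

Section BlowUp.
Variables (R : comPzRingType) (n m : nat) (color : 'I_m.+1 -> 'I_n.+1).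

(* The vertices of the i-th factor: those of Delta_i and, for i < n, the apex
   [ord_max] of the cone, placed after the vertices of Delta; vertex v of Delta
   is [lift ord_max v]. So the face (F, e) of the cone is the set F, together
   with the apex if e = 1; its degree |(F, e)| is its dimension, and the cup
   product on the cone is the one of the ordered simplex. *)
Definition factor_vertices (i : 'I_n.+1) : {set 'I_m.+2} :=
  [set w | if unlift ord_max w is Some v then color v == i else (i < n)%N]%SET.

Definition blow_face : Type :=
  {dffun forall i : 'I_n.+1, face (factor_vertices i)}.

HB.instance Definition _ := Finite.on blow_face.

Definition blow_deg (B : blow_face) : nat := (\sum_i fdeg (B i))%N.

(* The tensor product N^*(c Delta_0) (x) ... (x) N^*(Delta_n), by coordinates in
   the basis 1_(F, e). *)
Definition blowup : Type := {ffun blow_face -> R^o}.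

HB.instance Definition _ := GRing.Lmodule.on blowup.

Definition tensor (f : forall i, cochain R (factor_vertices i)) : blowup :=
  [ffun B : blow_face => \prod_i f i (B i)].

Definition blow_coboundary_indic (B : blow_face) : blowup :=
  \sum_(i : 'I_n.+1) (-1) ^+ (\sum_(j : 'I_n.+1 | (j < i)%N) fdeg (B j))%N *:
    tensor (fun j => if j == i then coboundary (indic R (B j))
                     else indic R (B j)).

Definition blow_coboundary (w : blowup) : blowup :=
  \sum_B w B *: blow_coboundary_indic B.

Definition blow_cup_indic (B C : blow_face) : blowup :=
  (-1) ^+ (\sum_(i : 'I_n.+1) \sum_(j : 'I_n.+1 | (j < i)%N)
             fdeg (B i) * fdeg (C j))%N *:
    tensor (fun i => cup_indic R (B i) (C i)).

Definition blow_cup (w e : blowup) : blowup :=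
  \sum_B \sum_C (w B * e C) *: blow_cup_indic B C.

Definition homogeneous (k : nat) (w : blowup) : Prop :=
  forall B, w B != 0 -> blow_deg B = k.

Definition has_apex (B : blow_face) (i : nat) : bool :=
  [exists j : 'I_n.+1, (j == i :> nat) && (ord_max \in vertices (B j))].

Definition indic_norm (l : nat) (B : blow_face) : \bar int :=
  if has_apex B (n - l) then -oo%E
  else ((\sum_(i : 'I_n.+1 | (n - l < i)%N) fdeg (B i))%N%:Z)%:E%E.

Definition blow_norm (l : nat) (w : blowup) : \bar int :=
  \big[Order.max/-oo%E]_(B | w B != 0) indic_norm l B.

End BlowUp.

Section Restriction.
Variables (R : comPzRingType) (n m : nat) (color : 'I_m.+2 -> 'I_n.+1).
Variable l : 'I_m.+2.

(* The inclusion of the face opposite to l, on the vertices of the cones. *)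
Definition cone_lift (w : 'I_m.+2) : 'I_m.+3 :=
  if unlift ord_max w is Some v then lift ord_max (lift l v) else ord_max.

Lemma cone_lift_face i (F : face (factor_vertices (color \o lift l) i)) :
  (0 < #|(cone_lift @: vertices F)%SET|)%N &&
  ((cone_lift @: vertices F)%SET \subset factor_vertices color i).
Proof.
have /andP[F0 /fintype.subsetP sF] := valP F; apply/andP; split.
  move/card_gt0P: F0 => [v vF]; apply/card_gt0P.
  by exists (cone_lift v); apply: imset_f.
apply/fintype.subsetP => _ /imsetP[w wF ->].
move: (sF w wF); rewrite !inE /cone_lift; case: (unlift ord_max w) => [v|].
  by rewrite liftK.
by rewrite unlift_none.
Qed.

Definition push_factor i (F : face (factor_vertices (color \o lift l) i)) :
  face (factor_vertices color i) :=
  Sub (cone_lift @: vertices F)%SET (cone_lift_face F).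

Definition push_face (B : blow_face (color \o lift l)) : blow_face color :=
  finfun (fun i => push_factor (B i)).

Definition blow_restrict (w : blowup R color) : blowup R (color \o lift l) :=
  [ffun B => w (push_face B)].

End Restriction.
(* X_(i-1), which is empty for i = 0. *)
Definition skel_below (T : Type) (n : nat) (skel : 'I_n.+1 -> set T)
    (i : 'I_n.+1) : set T :=
  \bigcup_(j in [set j : 'I_n.+1 | (j < i)%N]) skel j.

Record filteredSpace := FilteredSpace {
  fspace :> topologicalType;
  fdim : nat;
  skel : 'I_fdim.+1 -> set fspace;
  fspace_hausdorff : hausdorff_space fspace;
  skel_closed : forall i, closed (skel i);
  skel_mono : forall i j : 'I_fdim.+1, (i <= j)%N -> skel i `<=` skel j;
  skel_max : skel ord_max = [set: fspace];
  skel_proper : skel_below skel ord_max <> [set: fspace] }.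

Arguments skel : clear implicits.

Definition layer (X : filteredSpace) (i : 'I_(fdim X).+1) : set X :=
  skel X i `\` skel_below (skel X) i.

Record stratum (X : filteredSpace) := Stratum {
  stratum_dim : 'I_(fdim X).+1;
  stratum_set :> set X;
  stratumP : exists2 x, layer stratum_dim x &
             stratum_set = connected_component (layer stratum_dim) x }.

Definition codim (X : filteredSpace) (S : stratum X) : nat :=
  (fdim X - stratum_dim S)%N.

Definition regular_stratum (X : filteredSpace) (S : stratum X) : bool :=
  codim S == 0%N.

Definition singular_stratum (X : filteredSpace) (S : stratum X) : bool :=
  ~~ regular_stratum S.

Record perversity (X : filteredSpace) := Perversity {
  perv_fun :> stratum X -> \bar int;
  perv_regular : forall S, regular_stratum S -> perv_fun S = 0%E }.

Lemma perversity_eq (X : filteredSpace) (p q : perversity X) :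
  (forall S, p S = q S) -> p = q.
Proof.
case: p q => [p hp] [q hq] /= /funext e; rewrite e in hp *.
by congr Perversity; exact: Prop_irrelevance.
Qed.

(* In [\bar int], as for perversities, +oo + -oo = -oo. *)
Definition pervD (X : filteredSpace) (p q : perversity X) : perversity X.
Proof.
exists (fun S => (p S + q S)%E) => S hS.
by rewrite !perv_regular // adde0.
Defined.

Definition perv0 (X : filteredSpace) : perversity X.
Proof. by exists (fun=> 0%E). Defined.

Lemma pervDC (X : filteredSpace) (p q : perversity X) : pervD p q = pervD q p.
Proof. by apply: perversity_eq => S; exact: addeC. Qed.

Lemma pervDA (X : filteredSpace) (p q r : perversity X) :
  pervD p (pervD q r) = pervD (pervD p q) r.
Proof. by apply: perversity_eq => S; exact: addeA. Qed.

Lemma perv0D (X : filteredSpace) (p : perversity X) : pervD (perv0 X) p = p.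
Proof. by apply: perversity_eq => S; exact: add0e. Qed.

Lemma pervD0 (X : filteredSpace) (p : perversity X) : pervD p (perv0 X) = p.
Proof. by apply: perversity_eq => S; exact: adde0. Qed.

Section Simplices.
Variable K : realType.

Definition std_simplex (m : nat) : set 'rV[K]_m.+1 :=
  [set t | (forall v, 0 <= t 0 v) /\ \sum_v t 0 v = 1].

Arguments std_simplex : clear implicits.

Definition bary (m : nat) (t : std_simplex m) : 'rV[K]_m.+1 := set_val t.

Definition face_row (m : nat) (l : 'I_m.+2) (t : 'rV[K]_m.+1) : 'rV[K]_m.+2 :=
  \row_v (if unlift l v is Some u then t 0 u else 0).

Lemma face_row_lift m (l : 'I_m.+2) (t : 'rV[K]_m.+1) v :
  face_row l t 0 (lift l v) = t 0 v.
Proof. by rewrite mxE liftK. Qed.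

Lemma face_row_same m (l : 'I_m.+2) (t : 'rV[K]_m.+1) : face_row l t 0 l = 0.
Proof. by rewrite mxE unlift_none. Qed.

Lemma face_row_std m (l : 'I_m.+2) (t : std_simplex m) :
  face_row l (bary t) \in std_simplex m.+1.
Proof.
have [t0 t1] := set_valP t.
rewrite inE; split=> [v|].
  by rewrite mxE; case: unliftP => [u _|_].
rewrite (bigD1_ord l) //= face_row_same add0r -t1.
by apply: eq_bigr => v _; rewrite face_row_lift.
Qed.

Definition face_incl (m : nat) (l : 'I_m.+2) (t : std_simplex m) :
  std_simplex m.+1 := exist _ (face_row l (bary t)) (face_row_std l t).

Lemma face_incl_continuous m (l : 'I_m.+2) : continuous (@face_incl m l).
Proof.
apply: continuous_comp_initial => t.
apply: (@continuous_comp _ _ _ (@bary m) (face_row l)).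
  exact: initial_continuous.
move: (bary t) => {}t U [P Pt PU].
rewrite /nbhs /=.
exists (fun i j => [set x | forall v, v == lift l j -> P i v x]).
  move=> i j; have := Pt i (lift l j); rewrite (ord1 i) face_row_lift.
  by apply: filterS => x Px v /eqP ->.
move=> s sP; apply: PU => i v; rewrite (ord1 i).
case: (unliftP l v) => [u ->|->].
  by rewrite face_row_lift; have := sP 0 u; apply.
by rewrite face_row_same; apply: nbhs_singleton; have := Pt 0 l;
  rewrite face_row_same.
Qed.

Variable X : filteredSpace.
Let n := fdim X.

(* The join decomposition of the simplex with vertices 0 < ... < m is given by
   [color], mapping each vertex to the index of the join factor it spans:
   the vertices of Delta_i are those of color i. *)
Definition join_upto m (color : 'I_m.+1 -> 'I_n.+1) (i : 'I_n.+1) :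
  set (std_simplex m) :=
  [set t | forall v, (i < color v)%N -> bary t 0 v = 0].

Record regular_simplex (m : nat) := RegularSimplex {
  color : 'I_m.+1 -> 'I_n.+1;
  smap :> std_simplex m -> X;
  color_mono : forall u v : 'I_m.+1, (u <= v)%N -> (color u <= color v)%N;
  smap_continuous : continuous smap;
  smap_filtered : forall i, smap @^-1` (skel X i) = join_upto color i;
  color_regular : exists v, color v = ord_max }.

(* The hypothesis hl says that the face opposite to l still meets Delta_n. *)
Definition regular_face m (s : regular_simplex m.+1) (l : 'I_m.+2)
    (hl : exists v, color s (lift l v) = ord_max) : regular_simplex m.
Proof.
exists (color s \o lift l) (smap s \o @face_incl m l).
- move=> u v uv; apply: color_mono => /=.
  by rewrite leq_bump2.
- move=> t; apply: continuous_comp; first exact: face_incl_continuous.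
  exact: smap_continuous.
- move=> i; rewrite comp_preimage smap_filtered.
  apply/seteqP; split=> t /= h v.
    by move=> iv; have := h _ iv; rewrite face_row_lift.
  case: (unliftP l v) => [u ->|->].
    by rewrite face_row_lift => /h.
  by rewrite face_row_same.
- exact: hl.
Defined.

End Simplices.

Arguments std_simplex : clear implicits.
Arguments regular_simplex : clear implicits.

Section LocalLinear.
Variables (R : comPzRingType) (n m : nat) (color : 'I_m.+1 -> 'I_n.+1).
Implicit Types (w e : blowup R color).

Lemma blow_coboundary_linear : linear (@blow_coboundary R n m color).
Proof.
move=> a w e; rewrite /blow_coboundary scaler_sumr -big_split /=.
by apply: eq_bigr => B _; rewrite !ffunE scalerDl scalerA.
Qed.

Lemma homogeneousP k a w e :
  homogeneous k w -> homogeneous k e -> homogeneous k (a *: w + e).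
Proof.
move=> hw he B; rewrite !ffunE; have [->|w0 _] := eqVneq (w B) 0.
  by rewrite scaler0 add0r => /he.
exact: hw.
Qed.

Lemma blow_norm_leP l w (x : \bar int) :
  (blow_norm l w <= x)%O <-> forall B, w B != 0 -> (indic_norm l B <= x)%O.
Proof.
split=> [/bigmax_leP[_ h] //|h]; apply/bigmax_leP; split => //.
exact: leNye.
Qed.

Lemma blow_norm_le l a w e (x : \bar int) :
  (blow_norm l w <= x)%O -> (blow_norm l e <= x)%O ->
  (blow_norm l (a *: w + e) <= x)%O.
Proof.
move=> /blow_norm_leP hw /blow_norm_leP he; apply/blow_norm_leP => B.
rewrite !ffunE; have [->|w0 _] := eqVneq (w B) 0.
  by rewrite scaler0 add0r => /he.
exact: hw.
Qed.

End LocalLinear.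

Lemma ereal_int_supremums (A : set (\bar int)) :
  A !=set0 -> supremums A !=set0.
Proof.
move=> A0.
have [[z Az]|noub] := pselect (exists z : int, ubound A z%:E); last first.
  exists +oo%E; split=> [x _|y Ay]; first exact: leey.
  case: y Ay => [z /= Az||Ay]; [by case: noub; exists z|by []|].
  case: noub; exists 0 => x /Ay; case: x => //.
have [[y Ay]|nofin] := pselect (exists y : int, A y%:E); last first.
  exists -oo%E; split=> [x|y _]; last exact: leNye.
  case: x => [y Ay||//]; first by case: nofin; exists y.
  by move=> /Az.
have yz : y <= z by have := Az _ Ay; rewrite lee_fin.
pose P i := `[< ubound A (y + i%:Z)%:E >].
have exP : exists i, P i.
  exists `|z - y|%N; apply/asboolP => x /Az; rewrite gez0_abs ?subr_ge0 //.
  by rewrite [y + _]addrC subrK.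
case: (ex_minnP exP) => i /asboolP Pi imin.
exists (y + i%:Z)%:E; split=> // -[u Au||Au]; [|by rewrite leey|].
  rewrite lee_fin; have yu : y <= u by have := Au _ Ay; rewrite lee_fin.
  rewrite -lerBrDl -[u - y]gez0_abs ?subr_ge0 // lez_nat; apply: imin.
  by apply/asboolP => x /Au; rewrite gez0_abs ?subr_ge0 // [y + _]addrC subrK.
by have := Au _ Ay.
Qed.

Lemma ereal_int_supremum_le (A : set (\bar int)) (x : \bar int) :
  (supremum -oo%E A <= x)%O <-> ubound A x.
Proof.
have [->|A0] := eqVneq A set0.
  by rewrite supremum0; split=> [_ y []|_]; exact: leNye.
have /set0P/ereal_int_supremums hs := A0; split=> [h y Ay|h].
  by apply: le_trans h; exact: ge_supremum_Nmem.
rewrite /supremum (negbTE A0).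
by case: xgetP => [y _ [_ /(_ x h)]|/(_ _ (projT2 (cid hs)))].
Qed.

Section Complex.
Variables (K : realType) (R : comPzRingType) (X : filteredSpace).

Definition family : Type :=
  forall (m : nat) (s : regular_simplex K X m), blowup R (color s).

HB.instance Definition _ := gen_eqMixin family.
HB.instance Definition _ := gen_choiceMixin family.

Implicit Types w e : family.

Lemma familyP w e : (forall m s, w m s = e m s) -> w = e.
Proof.
move=> we; apply: functional_extensionality_dep => m.
by apply: functional_extensionality_dep => s.
Qed.

Definition family_zero : family := fun m s => 0.
Definition family_add w e : family := fun m s => w m s + e m s.
Definition family_opp w : family := fun m s => - w m s.
Definition family_scale (a : R) w : family := fun m s => a *: w m s.

Fact family_addA : associative family_add.
Proof. by move=> ? ? ?; apply: familyP => m s; exact: addrA. Qed.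
Fact family_addC : commutative family_add.
Proof. by move=> ? ?; apply: familyP => m s; exact: addrC. Qed.
Fact family_add0 : left_id family_zero family_add.
Proof. by move=> ?; apply: familyP => m s; exact: add0r. Qed.
Fact family_addN : left_inverse family_zero family_opp family_add.
Proof. by move=> ?; apply: familyP => m s; exact: addNr. Qed.

HB.instance Definition _ := GRing.isZmodule.Build family
  family_addA family_addC family_add0 family_addN.

Fact family_scaleA a b w :
  family_scale a (family_scale b w) = family_scale (a * b) w.
Proof. by apply: familyP => m s; exact: scalerA. Qed.
Fact family_scale1 : left_id 1 family_scale.
Proof. by move=> ?; apply: familyP => m s; exact: scale1r. Qed.
Fact family_scaleDr : right_distributive family_scale +%R.
Proof. by move=> ? ? ?; apply: familyP => m s; exact: scalerDr. Qed.
Fact family_scaleDl w : {morph family_scale^~ w : a b / a + b}.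
Proof. by move=> ? ?; apply: familyP => m s; exact: scalerDl. Qed.

HB.instance Definition _ := GRing.Zmodule_isLmodule.Build R family
  family_scaleA family_scale1 family_scaleDr family_scaleDl.

Definition family_coboundary w : family := fun m s => blow_coboundary (w m s).

Lemma family_coboundary_linear : linear family_coboundary.
Proof.
by move=> a w e; apply: familyP => m s; exact: blow_coboundary_linear.
Qed.

HB.instance Definition _ := GRing.isLinear.Build R family family *:%R
  family_coboundary family_coboundary_linear.

Definition blown_up (k : nat) w : Prop :=
  (forall m (s : regular_simplex K X m.+1) (l : 'I_m.+2)
          (hl : exists v, color s (lift l v) = ord_max),
     blow_restrict l (w _ s) = w _ (regular_face hl)) /\
  (forall m (s : regular_simplex K X m), homogeneous k (w m s)).

Definition perverse_degree w (S : stratum X) : \bar int :=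
  supremum -oo%E [set d | exists m (s : regular_simplex K X m),
    (range (smap s) `&` S) !=set0 /\ d = blow_norm (codim S) (w m s)].

Definition allowable (p : perversity X) w : Prop :=
  forall S, singular_stratum S -> (perverse_degree w S <= p S)%E.

Lemma allowable_le p a w e :
  allowable p w -> allowable p e -> allowable p (a *: w + e).
Proof.
move=> hw he S sS; apply/ereal_int_supremum_le => d /= [m [s [sm ->]]].
move: (hw S sS) (he S sS) => /ereal_int_supremum_le hwS.
move=> /ereal_int_supremum_le heS.
by apply: blow_norm_le; [apply: hwS|apply: heS]; exists m, s.
Qed.

Lemma allowable0 p : allowable p 0.
Proof.
move=> S sS; apply/ereal_int_supremum_le => d /= [m [s [sm ->]]].
by apply/blow_norm_leP => B; rewrite ffunE eqxx.
Qed.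

Variables (p : perversity X) (k : nat).

Definition icochain_pred : {pred family} := fun w =>
  `[< [/\ blown_up k w, allowable p w & allowable p (family_coboundary w)] >].

Fact icochain_pred_closed : submod_closed icochain_pred.
Proof.
split=> [|a w e].
  rewrite unfold_in; apply/asboolP; split.
  - split=> [m s l hl|m s B]; last by rewrite ffunE eqxx.
    by apply/ffunP => B; rewrite !ffunE.
  - exact: allowable0.
  - by rewrite linear0; exact: allowable0.
rewrite !unfold_in => /asboolP[[w1 w2] w3 w4] /asboolP[[e1 e2] e3 e4].
apply/asboolP; split.
- split=> [m s l hl|m s]; last exact: homogeneousP.
  by rewrite -[RHS]/(a *: w _ _ + e _ _) -w1 -e1; apply/ffunP => B; rewrite !ffunE.
- exact: allowable_le.
- by rewrite linearP; exact: allowable_le.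
Qed.

HB.instance Definition _ :=
  GRing.isSubmodClosed.Build R family icochain_pred icochain_pred_closed.

Record icochain : Type := ICochain {
  ival :> family;
  ivalP : ival \in icochain_pred }.

HB.instance Definition _ := [isSub for ival].
HB.instance Definition _ := [Choice of icochain by <:].
HB.instance Definition _ := [SubChoice_isSubLmodule of icochain by <:].

Definition icocycle_pred : {pred icochain} := fun w : icochain =>
  family_coboundary w == 0.

Fact icocycle_pred_closed : submod_closed icocycle_pred.
Proof.
split=> [|a w e].
  by rewrite unfold_in; apply/eqP; exact: (linear0 family_coboundary).
rewrite !unfold_in => /eqP hw /eqP he; apply/eqP.
rewrite (_ : ival _ = a *: ival w + ival e) //.
by rewrite linearP /= hw he scaler0 addr0.
Qed.

HB.instance Definition _ :=
  GRing.isSubmodClosed.Build R icochain icocycle_pred icocycle_pred_closed.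

Record icocycle : Type := ICocycle {
  cval :> icochain;
  cvalP : cval \in icocycle_pred }.

HB.instance Definition _ := [isSub for cval].
HB.instance Definition _ := [Choice of icocycle by <:].
HB.instance Definition _ := [SubChoice_isSubLmodule of icocycle by <:].

End Complex.

Section Cohomology.
Variables (K : realType) (R : comPzRingType) (X : filteredSpace).
Variables (p : perversity X) (k : nat).
Local Notation Z := (icocycle K R p k).

Definition icoboundary_pred : {pred Z} := fun w =>
  `[< if k is j.+1 then exists e : icochain K R p j, ival w = family_coboundary e
      else w = 0 >].

Fact icoboundary_pred_closed : submod_closed icoboundary_pred.
Proof.
rewrite /icoboundary_pred; split=> [|a w e]; rewrite !unfold_in.
  apply/asboolP; case: k => // j.
  by exists 0; rewrite linear0.
move=> /asboolP hw /asboolP he; apply/asboolP; move: w e hw he.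
case: k => [w e -> ->|j w e [w' hw] [e' he]]; first by rewrite scaler0 addr0.
by exists (a *: w' + e'); rewrite linearP /= -hw -he.
Qed.

HB.instance Definition _ :=
  GRing.isSubmodClosed.Build R Z icoboundary_pred icoboundary_pred_closed.

Definition cohomology : Type := Quotient.quot icoboundary_pred.

HB.instance Definition _ := GRing.Zmodule.on cohomology.

Definition coclass (w : Z) : cohomology := \pi_(Quotient.quot icoboundary_pred)%qT w.

Lemma coclass_eq (w e : Z) :
  coclass w = coclass e <-> w - e \in icoboundary_pred.
Proof. by rewrite Quotient.idealrBE; split=> [/eqP|/eqP]. Qed.

Lemma coclass_surj (x : cohomology) : exists w, x = coclass w.
Proof. by exists (repr x); rewrite /coclass reprK. Qed.

Lemma coclassD (w e : Z) : coclass (w + e) = coclass w + coclass e.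
Proof. exact: Quotient.pi_add. Qed.

Definition cohomology_scale (a : R) (x : cohomology) : cohomology :=
  coclass (a *: (repr x : Z)).

Lemma cohomology_scaleE a w : cohomology_scale a (coclass w) = coclass (a *: w).
Proof.
apply/coclass_eq; rewrite -scalerBr rpredZ //; apply/coclass_eq.
by rewrite /coclass reprK.
Qed.

Fact cohomology_scaleA a b x :
  cohomology_scale a (cohomology_scale b x) = cohomology_scale (a * b) x.
Proof. by have [w ->] := coclass_surj x; rewrite !cohomology_scaleE scalerA. Qed.
Fact cohomology_scale1 : left_id 1 cohomology_scale.
Proof.
by move=> x; have [w ->] := coclass_surj x; rewrite cohomology_scaleE scale1r.
Qed.
Fact cohomology_scaleDr : right_distributive cohomology_scale +%R.
Proof.
move=> a x y; have [[w ->] [e ->]] := (coclass_surj x, coclass_surj y).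
by rewrite -coclassD !cohomology_scaleE scalerDr coclassD.
Qed.
Fact cohomology_scaleDl x : {morph cohomology_scale^~ x : a b / a + b}.
Proof.
move=> a b; have [w ->] := coclass_surj x.
by rewrite !cohomology_scaleE scalerDl coclassD.
Qed.

HB.instance Definition _ := GRing.Zmodule_isLmodule.Build R cohomology
  cohomology_scaleA cohomology_scale1 cohomology_scaleDr cohomology_scaleDl.

End Cohomology.

Arguments ival {K R X p k} _.
Arguments icochain K R {X} p k.
Arguments icocycle K R {X} p k.
Arguments cohomology K R {X} p k.

Definition cast_cohomology (K : realType) (R : comPzRingType)
    (X : filteredSpace) (p q : perversity X) (k l : nat) (pq : p = q)
    (kl : k = l) (x : cohomology K R p k) : cohomology K R q l :=
  ecast q (cohomology K R q l) pq (ecast l (cohomology K R p l) kl x).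

Definition bilinear_map (R : comPzRingType) (U V W : lmodType R)
    (f : U -> V -> W) : Prop :=
  (forall u, linear (f u)) /\ (forall v, linear (f^~ v)).

(* Main.v *)
Require Import Defs.
From HB Require Import structures.
From mathcomp Require Import all_boot all_order all_algebra.
From mathcomp Require Import all_classical all_reals.
From mathcomp Require Import topology normedtype.
From mathcomp Require Import ring zify.

Set Implicit Arguments.
Unset Strict Implicit.
Unset Printing Implicit Defensive.

Import Order.TTheory GRing.Theory Num.Theory.

Local Open Scope ring_scope.

(** Everything except commutativity is already true on the blow-up of one
    simplex, and passes to families face by face. Commutativity holds only up
    to homotopy, and the point is to find a homotopy between the cup product
    and its opposite that commutes with restriction to faces and respects
    perverse degrees.

    One ordered simplex. A cochain is a function on words, the increasing
    lists of vertices. Reading words from their first letter gives one-line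
    recursions for the coboundary d, the cup product, the opposite product
    cop (f, g) = (-1)^(|f||g|) g cup f, and a cup-one product in the sense of
    Steenrod. Induction on the word then proves the Leibniz rules
    [word_cob_cup] and [word_cob_cop], associativity [word_cupA] and the
    homotopy formula [word_cob_cup1]:
      d (f cup1 g) + df cup1 g + (-1)^|f| f cup1 dg = f cup g - cop (f, g).

    Tensor products. On a blow-up each operation has a kernel: a Koszul sign
    times the product over the factors of local kernels. Composing such a
    kernel with the coboundary, on either side, gives a sum over the factors
    in which a single local kernel is changed ([tensor2_then_tensor1],
    [tensor1_then_tensor2]). The Leibniz rule is therefore local. The homotopy
    is the sum over the factors a of the operation that is cop before a, cup1
    at a and cup after a: its boundary replaces cup1 by cup - cop, so the sum
    telescopes to cup - cop on the whole tensor product ([tensor2_homotopy]).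

    Perverse degrees. For all these operations the product of the basis
    elements of B and C only involves D with D_i the union of B_i and C_i,
    where B_i and C_i have a common vertex. Hence D has the apex of a factor
    exactly when B or C has it, and |D_i| <= |B_i| + |C_i|; so perverse degrees
    are subadditive, the value -oo included ([norm_op]). Since B_i and C_i are
    faces of D_i, the value of a product on a face only depends on the values
    of the arguments on that face ([restrict_op]).

    Cohomology. The Leibniz rule makes the product well defined on classes. For
    cocycles w and e, the homotopy formula exhibits the difference of w cup e
    and (-1)^(|w||e|) e cup w as the coboundary of w cup1 e, which is zero when
    both degrees are zero. The unit is the sum of the basis elements of
    degree 0; it is a cocycle since the Leibniz rule for 1 cup 1 = 1 reads
    d1 = d1 + d1. *)

(** * Cochains as functions on words *)

Section WordCochains.
Variables (R : comPzRingType) (T : eqType).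
Implicit Types (f g h : seq T -> R) (s u v : seq T) (x : T) (a b : R).

Definition prepend x f : seq T -> R := fun s => f (x :: s).
(** The sign (-1)^|f|: a nonempty word of size k + 1 has degree k. *)
Definition twist f : seq T -> R := fun s => (-1) ^+ (size s).+1 * f s.

(** The coboundary is the sign of [twist] times the transpose of the boundary,
    and the recursion separates the face opposite to the first letter. The
    empty word counts as a face here: it appears when a recursion strips the
    last letter, although the cochains of interest vanish on it. *)
Fixpoint word_cob f s : R :=
  if s is x :: s' then word_cob (prepend x f) s' - twist f s' else 0.

(** The first term has the splitting letter at x. Otherwise x belongs to the
    word of f, whose degree grows by one: this turns the sign (-1)^(|f||g|)
    into the twist of g. *)
Fixpoint word_cup f g s : R :=
  if s is x :: s' then f [:: x] * g s + word_cup (prepend x f) (twist g) s'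
  else 0.

(** The opposite product (-1)^(|f||g|) g cup f; the sign cancels that of the cup
    product. *)
Fixpoint word_cop f g s : R :=
  if s is x :: s' then g [:: x] * f s + word_cop f (prepend x g) s' else 0.

(** In f cup1 g the word of f is an interval with ends x_i < x_j, and that of g
    consists of the letters up to x_i and from x_j on. In the first term x
    comes before the interval and belongs to g only; in the second one x is the
    left end, and the right end is the letter at which the cup product
    splits. *)
Fixpoint word_cup1 f g s : R :=
  if s is x :: s' then
    word_cup1 f (prepend x g) s' + word_cup (twist (prepend x f)) (prepend x g) s'
  else 0.

Let sub_cons x u s : subseq u s -> subseq u (x :: s).
Proof. by move=> us; apply: (subseq_trans us); exact: subseq_cons. Qed.

Let sub_cons2 x u s : subseq u s -> subseq (x :: u) (x :: s).
Proof. by move=> us /=; rewrite eqxx. Qed.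

Let sub_head x s : subseq [:: x] (x :: s).
Proof. by rewrite /= eqxx sub0seq. Qed.

(** The operations at s only evaluate their arguments at nonempty subwords of
    s; the following congruence lemmas record this locality. *)
Definition eq_below s f g := forall u, subseq u s -> u != [::] -> f u = g u.

Lemma eq_below_cons x s f g : eq_below (x :: s) f g -> eq_below s f g.
Proof. by move=> fg u us; apply: fg; exact: sub_cons. Qed.

Lemma eq_below_prepend x s f g :
  eq_below (x :: s) f g -> eq_below s (prepend x f) (prepend x g).
Proof. by move=> fg u us _; apply: fg => //; exact: sub_cons2. Qed.

Lemma eq_below_twist s f g : eq_below s f g -> eq_below s (twist f) (twist g).
Proof. by move=> fg u us u0; rewrite /twist fg. Qed.

Lemma eq_word_cob f g s : f =1 g -> word_cob f s = word_cob g s.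
Proof.
move=> fg; elim: s f g fg => //= x s IH f g fg.
by rewrite /twist fg (IH _ (prepend x g)) // => u; exact: fg.
Qed.

Lemma eq_below_word_cob f g s :
  eq_below s f g -> f [::] = g [::] -> word_cob f s = word_cob g s.
Proof.
elim: s f g => //= x s IH f g fg fg0; congr (_ - _).
  apply: IH; first exact: eq_below_prepend.
  by apply: fg; rewrite ?sub_head.
rewrite /twist; have [->|s0] := eqVneq s [::]; first by rewrite fg0.
by rewrite fg //; exact: subseq_cons.
Qed.

Lemma eq_word_cup f f' g g' s :
  eq_below s f f' -> eq_below s g g' -> word_cup f g s = word_cup f' g' s.
Proof.
elim: s f f' g g' => // x s IH f f' g g' ff gg /=.
rewrite ff ?sub_head // gg //; congr (_ + _); apply: IH.
  exact: eq_below_prepend.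
by apply: eq_below_twist; exact: eq_below_cons gg.
Qed.

Lemma eq_word_cop f f' g g' s :
  eq_below s f f' -> eq_below s g g' -> word_cop f g s = word_cop f' g' s.
Proof.
elim: s f f' g g' => // x s IH f f' g g' ff gg /=.
rewrite ff // gg ?sub_head //; congr (_ + _); apply: IH.
  exact: eq_below_cons ff.
exact: eq_below_prepend.
Qed.

Lemma eq_word_cup1 f f' g g' s :
  eq_below s f f' -> eq_below s g g' -> word_cup1 f g s = word_cup1 f' g' s.
Proof.
elim: s f f' g g' => // x s IH f f' g g' ff gg /=; congr (_ + _).
  by apply: IH; [exact: eq_below_cons ff|exact: eq_below_prepend].
by apply: eq_word_cup; [apply: eq_below_twist|]; exact: eq_below_prepend.
Qed.

Lemma twistK f s : twist (twist f) s = f s.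
Proof. by rewrite /twist mulrA -exprD addnn -muln2 exprM sqrr_sign mul1r. Qed.

Lemma twist_prepend x f s : prepend x (twist f) s = - twist (prepend x f) s.
Proof. by rewrite /twist /prepend /= exprS mulN1r mulNr. Qed.

Lemma word_cob_linear a b f g s :
  word_cob (fun u => a * f u + b * g u) s = a * word_cob f s + b * word_cob g s.
Proof.
elim: s f g => [|x s IH] f g /=; first by rewrite !mulr0 addr0.
by rewrite (IH (prepend x f) (prepend x g)) /twist; ring.
Qed.

Lemma word_cup_linearl a b f f' g s :
  word_cup (fun u => a * f u + b * f' u) g s
  = a * word_cup f g s + b * word_cup f' g s.
Proof.
elim: s f f' g => [|x s IH] f f' g /=; first by rewrite !mulr0 addr0.
by rewrite (IH (prepend x f) (prepend x f')); ring.
Qed.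

Lemma word_cup_linearr a b f g g' s :
  word_cup f (fun u => a * g u + b * g' u) s
  = a * word_cup f g s + b * word_cup f g' s.
Proof.
elim: s f g g' => [|x s IH] f g g' /=; first by rewrite !mulr0 addr0.
rewrite (@eq_word_cup _ (prepend x f) _
  (fun u => a * twist g u + b * twist g' u)) //; first by rewrite IH; ring.
by move=> u _ _; rewrite /twist; ring.
Qed.

Lemma word_cop_linearl a b f f' g s :
  word_cop (fun u => a * f u + b * f' u) g s
  = a * word_cop f g s + b * word_cop f' g s.
Proof.
elim: s f f' g => [|x s IH] f f' g /=; first by rewrite !mulr0 addr0.
by rewrite IH; ring.
Qed.

Lemma word_cop_linearr a b f g g' s :
  word_cop f (fun u => a * g u + b * g' u) s
  = a * word_cop f g s + b * word_cop f g' s.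
Proof.
elim: s f g g' => [|x s IH] f g g' /=; first by rewrite !mulr0 addr0.
by rewrite (IH _ (prepend x g) (prepend x g')); ring.
Qed.

Lemma word_cup1_linearl a b f f' g s :
  word_cup1 (fun u => a * f u + b * f' u) g s
  = a * word_cup1 f g s + b * word_cup1 f' g s.
Proof.
elim: s f f' g => [|x s IH] f f' g /=; first by rewrite !mulr0 addr0.
rewrite IH (@eq_word_cup _ (fun u => a * twist (prepend x f) u
  + b * twist (prepend x f') u) _ (prepend x g)) //.
  by rewrite word_cup_linearl; ring.
by move=> u _ _; rewrite /twist /prepend; ring.
Qed.

Lemma word_cup1_linearr a b f g g' s :
  word_cup1 f (fun u => a * g u + b * g' u) s
  = a * word_cup1 f g s + b * word_cup1 f g' s.
Proof.
elim: s f g g' => [|x s IH] f g g' /=; first by rewrite !mulr0 addr0.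
rewrite (IH _ (prepend x g) (prepend x g')).
by rewrite (word_cup_linearr _ _ _ (prepend x g) (prepend x g')); ring.
Qed.

Lemma twist_word_cob f s : twist (word_cob f) s = - word_cob (twist f) s.
Proof.
elim: s f => [|x s IH] f; first by rewrite /twist mulr0 oppr0.
have -> : twist (word_cob f) (x :: s) =
   - twist (word_cob (prepend x f)) s + twist (twist f) s.
  by rewrite /twist /= /twist !exprS; ring.
rewrite IH /= (@eq_word_cob (prepend x (twist f))
  (fun u => -1 * twist (prepend x f) u + 0 * f u)).
  by rewrite word_cob_linear; ring.
by move=> u; rewrite twist_prepend; ring.
Qed.

Lemma twist_word_cup f g s :
  twist (word_cup f g) s = word_cup (twist f) (twist g) s.
Proof.
elim: s f g => [|x s IH] f g; first by rewrite /twist mulr0.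
have -> : twist (word_cup f g) (x :: s) =
   twist f [:: x] * twist g (x :: s) - twist (word_cup (prepend x f) (twist g)) s.
  by rewrite /twist /= /twist !exprS expr0; ring.
rewrite IH /= (@eq_word_cup (prepend x (twist f))
  (fun u => -1 * twist (prepend x f) u + 0 * f u) (twist (twist g))
  (twist (twist g))) //.
  by rewrite word_cup_linearl; ring.
by move=> u _ _; rewrite twist_prepend; ring.
Qed.

Lemma twist_word_cop f g s :
  twist (word_cop f g) s = word_cop (twist f) (twist g) s.
Proof.
elim: s f g => [|x s IH] f g; first by rewrite /twist mulr0.
have -> : twist (word_cop f g) (x :: s) =
   twist g [:: x] * twist f (x :: s) - twist (word_cop f (prepend x g)) s.
  by rewrite /twist /= /twist !exprS expr0; ring.
rewrite IH /= (@eq_word_cop (twist f) (twist f) (prepend x (twist g))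
  (fun u => -1 * twist (prepend x g) u + 0 * g u)) //.
  by rewrite word_cop_linearr; ring.
by move=> u _ _; rewrite twist_prepend; ring.
Qed.

Lemma twist_word_cup1 f g s :
  twist (word_cup1 f g) s = - word_cup1 (twist f) (twist g) s.
Proof.
elim: s f g => [|x s IH] f g; first by rewrite /twist mulr0 oppr0.
have -> : twist (word_cup1 f g) (x :: s) = - twist (word_cup1 f (prepend x g)) s
   - twist (word_cup (twist (prepend x f)) (prepend x g)) s.
  by rewrite /twist /= /twist !exprS; ring.
rewrite IH twist_word_cup /= (@eq_word_cup1 (twist f) (twist f)
  (prepend x (twist g)) (fun u => -1 * twist (prepend x g) u + 0 * g u)) //;
  last by move=> u _ _; rewrite twist_prepend; ring.
rewrite word_cup1_linearr (@eq_word_cup (twist (prepend x (twist f)))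
  (fun u => -1 * twist (twist (prepend x f)) u + 0 * f u) (prepend x (twist g))
  (fun u => -1 * twist (prepend x g) u + 0 * g u)).
- by rewrite word_cup_linearl !word_cup_linearr; ring.
- by move=> u _ _; rewrite {1}/twist twist_prepend /twist; ring.
- by move=> u _ _; rewrite twist_prepend; ring.
Qed.

(** The last two terms are the defect of the Leibniz rule on cochains that do
    not vanish on the empty word. They cannot be dropped, because the induction
    applies the formula to [prepend x f], whose value at the empty word is
    [f [:: x]]. *)
Lemma word_cob_cup f g s :
  word_cob (word_cup f g) s =
  word_cup (word_cob f) g s + word_cup (twist f) (word_cob g) s
  - f [::] * g s - g [::] * twist f s.
Proof.
elim: s f g => [|x s IH] f g; first by rewrite /twist /=; ring.
rewrite /= -/(twist f) (@eq_word_cob (prepend x (word_cup f g))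
  (fun u => f [:: x] * prepend x g u + 1 * word_cup (prepend x f) (twist g) u));
  last by move=> u; rewrite mul1r.
rewrite word_cob_linear IH twist_word_cup.
rewrite (@eq_word_cup (prepend x (word_cob f))
  (fun u => 1 * word_cob (prepend x f) u + -1 * twist f u) (twist g) (twist g)) //;
  last by move=> u _ _; rewrite /prepend /=; ring.
rewrite word_cup_linearl.
rewrite (@eq_word_cup (prepend x (twist f))
  (fun u => -1 * twist (prepend x f) u + 0 * f u) (twist (word_cob g))
  (fun u => -1 * word_cob (twist g) u + 0 * g u)).
- by rewrite word_cup_linearl !word_cup_linearr /= /twist /prepend /= !exprS expr0; ring.
- by move=> u _ _; rewrite twist_prepend; ring.
- by move=> u _ _; rewrite twist_word_cob; ring.
Qed.

Lemma word_cob_cop f g s :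
  word_cob (word_cop f g) s =
  word_cop (word_cob f) g s + word_cop (twist f) (word_cob g) s
  - f [::] * g s - g [::] * twist f s.
Proof.
elim: s f g => [|x s IH] f g; first by rewrite /twist /=; ring.
rewrite /= (@eq_word_cob (prepend x (word_cop f g))
  (fun u => g [:: x] * prepend x f u + 1 * word_cop f (prepend x g) u));
  last by move=> u; rewrite mul1r.
rewrite word_cob_linear IH twist_word_cop.
rewrite (@eq_word_cop (twist f) (twist f) (prepend x (word_cob g))
  (fun u => 1 * word_cob (prepend x g) u + -1 * twist g u)) //;
  last by move=> u _ _; rewrite /prepend /=; ring.
by rewrite word_cop_linearr /twist /prepend /=; ring.
Qed.

(** Here the defects of [word_cob_cup] on the two truncated arguments are
    exactly the terms f(x) g and g(x) f by which the recursions of cup and cop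
    start, so that the formula holds for all functions on words. *)
Lemma word_cob_cup1 f g s :
  word_cob (word_cup1 f g) s =
  word_cup f g s - word_cop f g s
  - word_cup1 (word_cob f) g s - word_cup1 (twist f) (word_cob g) s.
Proof.
elim: s f g => [|x s IH] f g; first by rewrite /=; ring.
rewrite /= (@eq_word_cob (prepend x (word_cup1 f g))
  (fun u => 1 * word_cup1 f (prepend x g) u
          + 1 * word_cup (twist (prepend x f)) (prepend x g) u));
  last by move=> u; rewrite !mul1r.
rewrite word_cob_linear IH twist_word_cup1 word_cob_cup.
rewrite (@eq_word_cup1 (twist f) (twist f) (prepend x (word_cob g))
  (fun u => 1 * word_cob (prepend x g) u + -1 * twist g u)) //;
  last by move=> u _ _; rewrite /prepend /=; ring.
rewrite word_cup1_linearr.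
rewrite (@eq_word_cup (twist (prepend x (word_cob f)))
  (fun u => -1 * word_cob (twist (prepend x f)) u + -1 * f u)
  (prepend x g) (prepend x g)) //; last first.
  move=> u _ _; rewrite !mulN1r -twist_word_cob -[f u]twistK.
  by rewrite /twist /prepend /= /twist; ring.
rewrite (@eq_word_cup (twist (prepend x (twist f)))
  (fun u => -1 * prepend x f u + 0 * f u) (prepend x (word_cob g))
  (fun u => 1 * word_cob (prepend x g) u + -1 * twist g u)).
- rewrite !word_cup_linearl !word_cup_linearr.
  rewrite (@eq_word_cup (twist (twist (prepend x f))) (prepend x f)
     (word_cob (prepend x g)) (word_cob (prepend x g))) //;
    last by move=> u _ _; exact: twistK.
  by rewrite twistK /twist /prepend /=; ring.
- by move=> u _ _; rewrite {1}/twist twist_prepend mulrN -/(twist _ u) twistK; ring.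
- by move=> u _ _; rewrite /prepend /=; ring.
Qed.

Lemma word_cupA f g h s :
  word_cup (word_cup f g) h s = word_cup f (word_cup g h) s.
Proof.
elim: s f g h => // x s IH f g h /=.
rewrite (@eq_word_cup (prepend x (word_cup f g)) (fun u => f [:: x] *
  prepend x g u + 1 * word_cup (prepend x f) (twist g) u) (twist h) (twist h)) //;
  last by move=> u _ _; rewrite /prepend /=; ring.
rewrite word_cup_linearl IH (@eq_word_cup (prepend x f) (prepend x f)
  (twist (word_cup g h)) (word_cup (twist g) (twist h))) //.
  by ring.
by move=> u _ _; exact: twist_word_cup.
Qed.

Variant word_op := Cup | Cop | Cup1.

Definition word_eval (o : word_op) : (seq T -> R) -> (seq T -> R) -> seq T -> R :=
  match o with Cup => word_cup | Cop => word_cop | Cup1 => word_cup1 end.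

(** The cup-one product has degree -1. *)
Definition degree_drop (o : word_op) : nat := if o is Cup1 then 1 else 0.

Lemma eq_word_eval o f f' g g' s :
  eq_below s f f' -> eq_below s g g' -> word_eval o f g s = word_eval o f' g' s.
Proof.
by case: o; [exact: eq_word_cup|exact: eq_word_cop|exact: eq_word_cup1].
Qed.

Lemma word_eval_linearl o a b f f' g s :
  word_eval o (fun u => a * f u + b * f' u) g s
  = a * word_eval o f g s + b * word_eval o f' g s.
Proof.
by case: o;
  [exact: word_cup_linearl|exact: word_cop_linearl|exact: word_cup1_linearl].
Qed.

Lemma word_eval_linearr o a b f g g' s :
  word_eval o f (fun u => a * g u + b * g' u) s
  = a * word_eval o f g s + b * word_eval o f g' s.
Proof.
by case: o;
  [exact: word_cup_linearr|exact: word_cop_linearr|exact: word_cup1_linearr].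
Qed.

Lemma word_eval_nil o f g : word_eval o f g [::] = 0.
Proof. by case: o. Qed.

(** The pairs of words on which an operation lowering degrees by e evaluates
    its arguments. *)
Definition word_split (e : nat) s u v : Prop :=
  [/\ subseq u s, subseq v s, s =i u ++ v, has [in u] v
    & (size u + size v = size s + e.+1)%N].

Let has_cons x u v : has [in u] v -> has [in x :: u] v.
Proof. by apply: sub_has => z /= zu; rewrite inE zu orbT. Qed.

Lemma word_cup_split f g s :
  (forall u v, word_split 0 s u v -> f u * g v = 0) -> word_cup f g s = 0.
Proof.
elim: s f g => //= x s IH f g fg; rewrite fg ?add0r; last first.
  split; rewrite ?sub_head //= ?inE ?eqxx ?add1n ?addn1 // => z.
  by rewrite !inE; case: (z == x).
apply: IH => u v [us vs suv cuv euv].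
rewrite /prepend /twist mulrCA fg ?mulr0 //; split.
- exact: sub_cons2.
- exact: sub_cons.
- by move=> z; rewrite /= !inE suv.
- exact: has_cons.
- by rewrite /= addSn euv.
Qed.

Lemma word_cop_split f g s :
  (forall u v, word_split 0 s u v -> f u * g v = 0) -> word_cop f g s = 0.
Proof.
elim: s f g => //= x s IH f g fg; rewrite mulrC fg ?add0r; last first.
  split; rewrite ?sub_head //= ?inE ?eqxx ?addn1 // => z.
  by rewrite !inE mem_cat !inE; case: (z == x); rewrite ?orbT ?orbF.
apply: IH => u v [us vs suv cuv euv].
rewrite /prepend fg ?mulr0 //; split.
- exact: sub_cons.
- exact: sub_cons2.
- by move=> z; rewrite mem_cat !inE suv mem_cat orbCA.
- by rewrite /= cuv orbT.
- by rewrite /= addnS euv.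
Qed.

Lemma word_cup1_split f g s :
  (forall u v, word_split 1 s u v -> f u * g v = 0) -> word_cup1 f g s = 0.
Proof.
elim: s f g => //= x s IH f g fg.
rewrite IH ?word_cup_split ?addr0 // => u v [us vs suv cuv euv].
  rewrite /prepend /twist -mulrA fg ?mulr0 //; split.
  - exact: sub_cons2.
  - exact: sub_cons2.
  - by move=> z; rewrite mem_cat !inE suv mem_cat orbACA orbb.
  - by rewrite /= inE eqxx.
  - by rewrite /= addSn addnS euv !addnS.
rewrite /prepend fg ?mulr0 //; split.
- exact: sub_cons.
- exact: sub_cons2.
- by move=> z; rewrite mem_cat !inE suv mem_cat orbCA.
- by rewrite /= cuv orbT.
- by rewrite /= addnS euv.
Qed.

(** Supports of the operations. That the two words cover s controls the apex of
    a cone, and that they overlap bounds the degree of s by the sum of theirs. *)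
Lemma word_eval_split o f g s :
  (forall u v, word_split (degree_drop o) s u v -> f u * g v = 0) ->
  word_eval o f g s = 0.
Proof.
by case: o; [exact: word_cup_split|exact: word_cop_split|exact: word_cup1_split].
Qed.

End WordCochains.

(** * Renaming the letters *)

Section WordMap.
Variables (R : comPzRingType) (T U : eqType) (h : T -> U).
Implicit Types (f g : seq U -> R) (s : seq T).

Lemma word_cup_map f g s :
  word_cup f g (map h s) = word_cup (f \o map h) (g \o map h) s.
Proof.
elim: s f g => //= x s IH f g; rewrite IH; congr (_ + _).
by apply: eq_word_cup => // u _ _; rewrite /twist /= size_map.
Qed.

Lemma word_eval_map o f g s :
  word_eval o f g (map h s) = word_eval o (f \o map h) (g \o map h) s.
Proof.
case: o => /=; first exact: word_cup_map; elim: s f g => //= x s IH f g.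
  by rewrite IH.
rewrite IH word_cup_map; congr (_ + _).
by apply: eq_word_cup => // u _ _; rewrite /twist /= size_map.
Qed.

End WordMap.

(** * Increasing words and sets of vertices *)

Section OrderedWords.
Variables (R : comPzRingType) (k : nat).
Local Notation ord_lt := (fun x y : 'I_k => (x < y)%N).
Implicit Types (s u : seq 'I_k) (f g : seq 'I_k -> R) (F G : {set 'I_k}).

Let ord_lt_trans : transitive ord_lt.
Proof. by move=> y x z; exact: ltn_trans. Qed.

Let ord_lt_irr : irreflexive ord_lt.
Proof. by move=> x; rewrite ltnn. Qed.

Lemma sorted_enum F : sorted ord_lt (enum F).
Proof.
rewrite /enum_mem; apply: sorted_filter; first exact: ord_lt_trans.
rewrite -enumT; have := iota_ltn_sorted 0 k; rewrite -val_enum_ord sorted_map.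
by apply: sub_sorted.
Qed.

Lemma enum_of_sorted s : sorted ord_lt s -> enum [set x in s] = s.
Proof.
move=> ss; apply: (irr_sorted_eq ord_lt_trans ord_lt_irr) => //.
  exact: sorted_enum.
by move=> x; rewrite mem_enum inE.
Qed.

Lemma set_enum_id F : [set x in enum F] = F.
Proof. by apply/setP => x; rewrite inE mem_enum. Qed.

Lemma enum_imset l (h : 'I_k -> 'I_l) F :
  (forall x y : 'I_k, (x < y)%N -> (h x < h y)%N) ->
  enum (h @: F) = map h (enum F).
Proof.
move=> hmono.
apply: (@irr_sorted_eq _ (fun x y : 'I_l => (x < y)%N)).
- by move=> y x z; exact: ltn_trans.
- by move=> x; rewrite ltnn.
- rewrite /enum_mem; apply: sorted_filter.
    by move=> y x z; exact: ltn_trans.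
  rewrite -enumT; have := iota_ltn_sorted 0 l; rewrite -val_enum_ord sorted_map.
  by apply: sub_sorted.
- rewrite sorted_map; have := sorted_enum F; apply: sub_sorted => x y.
  exact: hmono.
- move=> x; rewrite mem_enum; apply/imsetP/mapP => -[y yF ->];
    exists y => //; first by rewrite mem_enum.
  by rewrite mem_enum in yF.
Qed.

Let sorted_cons x s : sorted ord_lt (x :: s) ->
  sorted ord_lt s /\ {in s, forall u : 'I_k, (x < u)%N}.
Proof.
move=> xs; split; first exact: path_sorted xs.
exact/allP/(order_path_min ord_lt_trans).
Qed.

Lemma word_cobE f s : sorted ord_lt s ->
  word_cob f s = \sum_(v <- s)
    (-1) ^+ ((size s).+1 + count (fun u : 'I_k => u < v)%N s)%N
    * f [seq u <- s | u != v].
Proof.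
elim: s f => [|x s IH] f; first by rewrite big_nil.
move=> /sorted_cons[ss ltx] /=; rewrite big_cons IH // addrC; congr (_ + _).
  rewrite eqxx ltnn /= (@eq_in_count _ _ pred0) ?count_pred0; last first.
    by move=> u us /=; have := ltx u us; lia.
  rewrite (@eq_in_filter _ _ predT) ?filter_predT; last first.
    by move=> u us /=; have := ltx u us; rewrite neq_ltn orbC => ->.
  by rewrite /twist !addn0 !exprS; ring.
apply: eq_big_seq => v vs; have xv := ltx v vs.
rewrite xv neq_ltn xv /prepend /= !addnS !addSn !exprS.
by rewrite !mulN1r opprK.
Qed.

Definition upto (v : 'I_k) s := [seq u : 'I_k <- s | (u <= v)%N].
Definition from (v : 'I_k) s := [seq u : 'I_k <- s | (v <= u)%N].

Lemma word_cupE f g s : sorted ord_lt s ->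
  word_cup f g s = \sum_(v <- s)
    (-1) ^+ ((size (upto v s)).-1
             * (size (from v s)).-1)%N
    * (f (upto v s) * g (from v s)).
Proof.
elim: s f g => [|x s IH] f g; first by rewrite big_nil.
move=> /sorted_cons[ss ltx] /=; rewrite big_cons IH //= /upto /from /=.
congr (_ + _).
  rewrite leqnn /= (@eq_in_filter _ _ pred0); last first.
    by move=> u us /=; have := ltx u us; lia.
  rewrite filter_pred0 /= (@eq_in_filter _ _ predT) ?filter_predT; last first.
    by move=> u us /=; have := ltx u us; lia.
  by rewrite mul0n mul1r.
apply: eq_big_seq => v vs; have xv := ltx v vs.
rewrite (ltnW xv) [(v <= x)%N]leqNgt xv /= /prepend /twist.
have lt0 : (0 < size (upto v s))%N.
  by rewrite size_filter -has_count; apply/hasP; exists v => /=.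
have gt0 : (0 < size (from v s))%N.
  by rewrite size_filter -has_count; apply/hasP; exists v => /=.
move: lt0 gt0; case: (size (upto v s)) => // a _.
case: (size (from v s)) => // b _ /=.
by rewrite mulSn exprD !exprS; ring.
Qed.

Lemma word_copE f g s : sorted ord_lt s ->
  word_cop f g s = \sum_(v <- s) g (upto v s) * f (from v s).
Proof.
elim: s f g => [|x s IH] f g; first by rewrite big_nil.
move=> /sorted_cons[ss ltx] /=; rewrite big_cons IH //= /upto /from /=.
congr (_ + _).
  rewrite leqnn /= (@eq_in_filter _ _ pred0); last first.
    by move=> u us /=; have := ltx u us; lia.
  rewrite filter_pred0 /= (@eq_in_filter _ _ predT) ?filter_predT //.
  by move=> u us /=; have := ltx u us; lia.
apply: eq_big_seq => v vs; have xv := ltx v vs.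
by rewrite (ltnW xv) [(v <= x)%N]leqNgt xv.
Qed.

End OrderedWords.

(** * From words to cochains of an ordered simplex *)

Section FaceCochains.
Variables (R : comPzRingType) (k : nat) (A : {set 'I_k}).
Local Notation ord_lt := (fun x y : 'I_k => (x < y)%N).
Implicit Types (F G H : face A) (f g : cochain R A) (s u : seq 'I_k).

(** The value is 0 on the words that do not span a face of A, the empty word
    among them. *)
Definition word_of f : seq 'I_k -> R :=
  fun s => if insub [set x in s] is Some F then f F else 0.

Definition word_in s : Prop := sorted ord_lt s /\ {subset s <= A}.

Lemma word_of_nil f : word_of f [::] = 0.
Proof.
rewrite /word_of insubF //.
by rewrite (_ : [set x in [::]] = finset.set0) ?cards0 //; apply/setP => x; rewrite !inE.
Qed.

Lemma word_of_face f F : word_of f (enum (vertices F)) = f F.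
Proof. by rewrite /word_of set_enum_id valK. Qed.

Lemma face_gt0 F : (0 < #|vertices F|)%N.
Proof. by have /andP[] := valP F. Qed.

Lemma face_sub F : vertices F \subset A.
Proof. by have /andP[] := valP F. Qed.

Lemma word_in_face F : word_in (enum (vertices F)).
Proof.
split; first exact: sorted_enum.
by move=> x; rewrite mem_enum; apply/fintype.subsetP/face_sub.
Qed.

Lemma word_in_sub s u : word_in s -> subseq u s -> word_in u.
Proof.
move=> [ss sA] us; split; last by move=> x /(mem_subseq us)/sA.
by apply: subseq_sorted us ss => y x z; exact: ltn_trans.
Qed.

Lemma word_inP s : word_in s -> s != [::] ->
  exists F, s = enum (vertices F).
Proof.
move=> [ss sA] s0.
have P : (0 < #|[set x in s]|)%N && ([set x in s] \subset A).
  apply/andP; split; last by apply/fintype.subsetP => x; rewrite inE; exact: sA.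
  by case: s s0 {ss sA} => // x s _; apply/card_gt0P; exists x; rewrite !inE eqxx.
by exists (Sub [set x in s] P); rewrite /vertices SubK enum_of_sorted.
Qed.

Lemma word_of_sum f s : word_of f s = \sum_(G | vertices G == [set x in s]) f G.
Proof.
rewrite /word_of; case: insubP => [F _ vF|].
  rewrite (big_pred1 F) // => G /=; rewrite -vF; apply/eqP/eqP => [|->//].
  exact: val_inj.
move=> nS; rewrite big_pred0 // => G; apply: contraNF nS => /eqP <-.
exact: (valP G).
Qed.

Lemma word_cob_of f s : word_in s -> word_cob (word_of f) s = word_of (coboundary f) s.
Proof.
have [->|s0 ins] := eqVneq s [::]; first by rewrite word_of_nil.
have [F ->] := word_inP ins s0; rewrite word_of_face ffunE.
rewrite word_cobE; last exact: sorted_enum.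
rewrite -sumrN.
transitivity (\sum_(v in vertices F) \sum_(G | vertices G == vertices F :\ v)
   - ((-1) ^+ fdeg G * ((-1) ^+ #|[set u in vertices F | (u < v)%N]| * f G))).
  rewrite big_enum; apply: eq_bigr => v vF.
  rewrite word_of_sum mulr_sumr; apply: eq_big => [G|G].
    congr (_ == _); apply/setP => u; rewrite !inE mem_filter mem_enum.
    by [].
  rewrite (_ : [set x in _] = vertices F :\ v); last first.
    by apply/setP => u; rewrite !inE mem_filter mem_enum.
  move=> /eqP vG.
  have sF : size (enum (vertices F)) = (fdeg G).+2.
    rewrite -cardE (cardsD1 v) vF add1n /fdeg -vG prednK //; exact: face_gt0.
  rewrite sF (_ : count _ _ = #|[set u in vertices F | (u < v)%N]|).
    by rewrite exprD !exprS; ring.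
  rewrite -size_filter cardE; apply/perm_size/uniq_perm;
    [exact/filter_uniq/enum_uniq|exact: enum_uniq|move=> u].
  by rewrite mem_filter !mem_enum inE andbC.
rewrite (exchange_big_dep predT) //=; apply: eq_bigr => G _.
rewrite ffunE mulr_suml mulr_sumr sumrN; congr (- _); exact: eq_bigl.
Qed.

Definition signed f : cochain R A := [ffun F => (-1) ^+ fdeg F * f F].

Lemma twist_word_of f s : uniq s -> twist (word_of f) s = word_of (signed f) s.
Proof.
move=> us; rewrite /twist /word_of; case: insubP => [F _ vF|_]; last exact: mulr0.
rewrite ffunE /fdeg /vertices vF cardsE (card_uniqP us).
have := face_gt0 F; rewrite /vertices vF cardsE (card_uniqP us).
by case: (size s) => // j _; rewrite /= !exprS; ring.
Qed.

Lemma word_in_uniq s : word_in s -> uniq s.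
Proof.
move=> [ss _]; apply: sorted_uniq ss; first by move=> y x z; exact: ltn_trans.
by move=> x; rewrite ltnn.
Qed.

(** The enumeration of a set of ordinals is increasing, so it is the word of
    the face. *)
Definition cochain_op o f g : cochain R A :=
  [ffun H => word_eval o (word_of f) (word_of g) (enum (vertices H))].

Lemma word_of_op o f g s : word_in s ->
  word_of (cochain_op o f g) s = word_eval o (word_of f) (word_of g) s.
Proof.
have [->|s0 ins] := eqVneq s [::]; first by rewrite word_of_nil word_eval_nil.
by have [F ->] := word_inP ins s0; rewrite word_of_face ffunE.
Qed.

Lemma word_of_linear a b f g s :
  word_of (a *: f + b *: g) s = a * word_of f s + b * word_of g s.
Proof.
rewrite /word_of; case: insub => [F|]; first by rewrite !ffunE.
by rewrite !mulr0 addr0.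
Qed.

Lemma cochain_op_linearl o a b f f' g :
  cochain_op o (a *: f + b *: f') g = a *: cochain_op o f g + b *: cochain_op o f' g.
Proof.
apply/ffunP => H; rewrite !ffunE -[RHS]word_eval_linearl.
by apply: eq_word_eval => // u _ _; rewrite word_of_linear.
Qed.

Lemma cochain_op_linearr o a b f g g' :
  cochain_op o f (a *: g + b *: g') = a *: cochain_op o f g + b *: cochain_op o f g'.
Proof.
apply/ffunP => H; rewrite !ffunE -[RHS]word_eval_linearr.
by apply: eq_word_eval => // u _ _; rewrite word_of_linear.
Qed.

Let eq_below_face H (x y : seq 'I_k -> R) :
  (forall u, word_in u -> x u = y u) -> eq_below (enum (vertices H)) x y.
Proof. by move=> xy u us _; apply/xy/word_in_sub/us/word_in_face. Qed.

Lemma coboundary_op o f g :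
  coboundary (cochain_op o f g) =
  [ffun H => word_cob (word_eval o (word_of f) (word_of g)) (enum (vertices H))].
Proof.
apply/ffunP => H; rewrite [RHS]ffunE -[LHS]word_of_face -word_cob_of;
  last exact: word_in_face.
apply: eq_below_word_cob; last by rewrite word_of_nil word_eval_nil.
by apply: eq_below_face => u iu; rewrite word_of_op.
Qed.

Lemma coboundary_cup f g :
  coboundary (cochain_op Cup f g) =
  cochain_op Cup (coboundary f) g + cochain_op Cup (signed f) (coboundary g).
Proof.
rewrite coboundary_op; apply/ffunP => H; rewrite !ffunE /= word_cob_cup.
rewrite !word_of_nil !mul0r !subr0; congr (_ + _); apply: eq_word_cup => //.
- by apply: eq_below_face => u iu; rewrite word_cob_of.
- by apply: eq_below_face => u iu; rewrite twist_word_of // word_in_uniq.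
- by apply: eq_below_face => u iu; rewrite word_cob_of.
Qed.

Lemma coboundary_cop f g :
  coboundary (cochain_op Cop f g) =
  cochain_op Cop (coboundary f) g + cochain_op Cop (signed f) (coboundary g).
Proof.
rewrite coboundary_op; apply/ffunP => H; rewrite !ffunE /= word_cob_cop.
rewrite !word_of_nil !mul0r !subr0; congr (_ + _); apply: eq_word_cop => //.
- by apply: eq_below_face => u iu; rewrite word_cob_of.
- by apply: eq_below_face => u iu; rewrite twist_word_of // word_in_uniq.
- by apply: eq_below_face => u iu; rewrite word_cob_of.
Qed.

Lemma coboundary_cup1 f g :
  coboundary (cochain_op Cup1 f g) =
  cochain_op Cup f g - cochain_op Cop f g
  - cochain_op Cup1 (coboundary f) g - cochain_op Cup1 (signed f) (coboundary g).
Proof.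
rewrite coboundary_op; apply/ffunP => H; rewrite !ffunE /= word_cob_cup1.
congr (_ - _ - _ - _); apply: eq_word_cup1 => //.
- by apply: eq_below_face => u iu; rewrite word_cob_of.
- by apply: eq_below_face => u iu; rewrite twist_word_of // word_in_uniq.
- by apply: eq_below_face => u iu; rewrite word_cob_of.
Qed.

Lemma cochain_cupA f g h :
  cochain_op Cup (cochain_op Cup f g) h = cochain_op Cup f (cochain_op Cup g h).
Proof.
apply/ffunP => H; rewrite !ffunE /=.
rewrite (@eq_word_cup _ _ _ (word_cup (word_of f) (word_of g)) _ (word_of h)) //.
  rewrite word_cupA; apply: eq_word_cup => //.
  by apply: eq_below_face => u iu; rewrite (word_of_op Cup).
by apply: eq_below_face => u iu; rewrite (word_of_op Cup).
Qed.

End FaceCochains.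

(** * Coefficients of the operations in the basis of indicators *)

Section Coefficients.
Variables (R : comPzRingType) (k : nat) (A : {set 'I_k}).
Implicit Types (F G H : face A) (f g : cochain R A) (s u : seq 'I_k).

Lemma word_of_indic F s :
  word_of (indic R F) s = ([set x in s] == vertices F)%:R.
Proof.
rewrite /word_of; case: insubP => [G _ vG|nS].
  by rewrite ffunE -vG (inj_eq val_inj).
case: eqP => // vF; move: nS; rewrite vF; case/negP.
exact: (valP F).
Qed.

Lemma word_of_indicM F G s u :
  word_of (indic R F) s * word_of (indic R G) u =
  ([set x in s] == vertices F)%:R * ([set x in u] == vertices G)%:R.
Proof. by congr (_ * _); exact: word_of_indic. Qed.

Definition op_coef o F G H : R := cochain_op o (indic R F) (indic R G) H.

Lemma cochain_indic_sum f : f = \sum_F f F *: indic R F.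
Proof.
apply/ffunP => G; rewrite sum_ffunE.
transitivity (\sum_F f F * (G == F)%:R : R); last first.
  by apply: eq_bigr => F _; rewrite /indic !ffunE.
rewrite (bigD1 G) //= eqxx mulr1 big1 ?addr0 // => F FG.
by rewrite eq_sym (negbTE FG) mulr0.
Qed.

Lemma cochain_op_suml o (I : finType) (a : I -> R) (x : I -> cochain R A) g :
  cochain_op o (\sum_i a i *: x i) g = \sum_i a i *: cochain_op o (x i) g.
Proof.
elim/big_rec2: _ => [|i y z _ <-].
  by have := cochain_op_linearl o 0 0 0 0 g; rewrite !scale0r addr0.
by rewrite -[z]scale1r cochain_op_linearl !scale1r.
Qed.

Lemma cochain_op_sumr o (I : finType) (a : I -> R) f (x : I -> cochain R A) :
  cochain_op o f (\sum_i a i *: x i) = \sum_i a i *: cochain_op o f (x i).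
Proof.
elim/big_rec2: _ => [|i y z _ <-].
  by have := cochain_op_linearr o 0 0 f 0 0; rewrite !scale0r addr0.
by rewrite -[z]scale1r cochain_op_linearr !scale1r.
Qed.

(** The support property that carries both allowability and naturality. *)
Lemma op_coef_neq0 o F G H : op_coef o F G H != 0 ->
  [/\ vertices H = vertices F :|: vertices G,
      vertices F :&: vertices G != finset.set0 &
      (fdeg F + fdeg G = fdeg H + degree_drop o)%N].
Proof.
rewrite /op_coef ffunE => c0.
suff /and3P[/eqP HFG FG0 /eqP degH] : [&& vertices H == vertices F :|: vertices G,
    vertices F :&: vertices G != finset.set0 &
    (fdeg F + fdeg G == fdeg H + degree_drop o)%N] by [].
apply: contraNT c0 => nP; apply/eqP/word_eval_split => u v [us vs suv cuv euv].
rewrite word_of_indicM; case: eqP => [Fu|_]; last by rewrite mul0r.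
case: eqP => [Gv|_]; last by rewrite mulr0.
case/negP: nP; apply/and3P; split.
- by apply/eqP/setP => x; rewrite -Fu -Gv !inE -mem_cat -suv mem_enum.
- have /hasP[x xv xu] := cuv; apply/set0Pn; exists x.
  by rewrite -Fu -Gv !inE xv andbT.
- have card_sub w : subseq w (enum (vertices H)) -> #|[set x in w]| = size w.
    by move=> /subseq_uniq/(_ (enum_uniq _))/card_uniqP <-; rewrite cardsE.
  move: (face_gt0 F) (face_gt0 G) (face_gt0 H) euv.
  rewrite /fdeg -Fu -Gv !card_sub // cardE.
  by case: (size u) (size v) (size (enum _)) => [|a] [|b] [|c] //= _ _ _; lia.
Qed.

(** Compatibility of F and G means that the union of F and G splits as F and G
    at their common vertex v0, the last one of F; no other vertex of the union
    splits it in this way, so that the sum over vertices has one nonzero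
    term. *)
Lemma cup_indicE F G : cup_indic R F G = cochain_op Cup (indic R F) (indic R G).
Proof.
apply/ffunP => H; rewrite !ffunE /= word_cupE; last exact: sorted_enum.
rewrite big_enum /=.
have uptoE v : [set x in upto v (enum (vertices H))] =
    [set x in vertices H | (x <= v)%N].
  by apply/setP => x; rewrite !inE mem_filter mem_enum andbC.
have fromE v : [set x in from v (enum (vertices H))] =
    [set x in vertices H | (v <= x)%N].
  by apply/setP => x; rewrite !inE mem_filter mem_enum andbC.
case: ifP => [/andP[/existsP[v0]]|nP]; last first.
  rewrite big1 // => v vH; rewrite word_of_indicM uptoE fromE.
  case: eqP => [vF|]; last by rewrite mul0r mulr0.
  case: eqP => [vG|]; last by rewrite !mulr0.
  move/negP: nP; case; apply/andP; split.
    apply/existsP; exists v; rewrite -vF -vG !inE vH leqnn /=.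
    by apply/andP; split; apply/forallP => x; apply/implyP; rewrite inE => /andP[].
  apply/eqP/setP => x; rewrite -vF -vG !inE -andb_orr.
  by rewrite leq_total andbT.
move=> /and3P[]; rewrite inE => /andP[v0F v0G].
move=> /forallP maxF /forallP minG /eqP HFG.
have v0H : v0 \in vertices H by rewrite HFG inE v0F.
rewrite (bigD1 v0) //= big1 ?addr0; last first.
  move=> v /andP[vH vv0]; rewrite word_of_indicM uptoE.
  case: eqP => [vF|]; last by rewrite mul0r mulr0.
  have := maxF v; rewrite -vF inE vH leqnn /= => le1.
  move: v0F; rewrite -vF inE => /andP[_ le2].
  by case/eqP: vv0; apply/val_inj/eqP; rewrite eqn_leq le1 le2.
rewrite word_of_indicM uptoE fromE.
have FE : [set x in vertices H | (x <= v0)%N] = vertices F.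
  apply/setP => x; rewrite inE HFG inE.
  apply/andP/idP => [[/orP[//|xG] xv]|xF]; last first.
    by rewrite xF; have := maxF x; rewrite xF.
  have := minG x; rewrite xG /= => v0x.
  by rewrite (_ : x = v0) //; apply/val_inj/eqP; rewrite eqn_leq xv.
have GE : [set x in vertices H | (v0 <= x)%N] = vertices G.
  apply/setP => x; rewrite inE HFG inE.
  apply/andP/idP => [[/orP[xF|//] xv]|xG]; last first.
    by rewrite xG orbT; have := minG x; rewrite xG.
  have := maxF x; rewrite xF /= => v0x.
  by rewrite (_ : x = v0) //; apply/val_inj/eqP; rewrite eqn_leq v0x.
rewrite FE GE !eqxx !mulr1 /fdeg -{1}FE -{1}GE !cardE.
congr (_ ^+ (_.-1 * _.-1)).
  apply/perm_size/uniq_perm;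
    [exact: enum_uniq|exact/filter_uniq/enum_uniq|move=> u].
  by rewrite mem_enum inE mem_filter mem_enum andbC.
apply/perm_size/uniq_perm;
  [exact: enum_uniq|exact/filter_uniq/enum_uniq|move=> u].
by rewrite mem_enum inE mem_filter mem_enum andbC.
Qed.

Definition unit_cochain : cochain R A := [ffun F => (fdeg F == 0%N)%:R].

Let word_unit s : R := (size s == 1%N)%:R.

Let word_of_unit s : word_in A s -> word_of unit_cochain s = word_unit s.
Proof.
have [->|s0 ins] := eqVneq s [::]; first by rewrite word_of_nil.
have [F ->] := word_inP ins s0; rewrite word_of_face ffunE /word_unit -cardE.
by rewrite /fdeg; case: #|_| (face_gt0 F).
Qed.

Lemma cup_unitl g : cochain_op Cup unit_cochain g = g.
Proof.
apply/ffunP => H; rewrite ffunE /= -[RHS]word_of_face.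
have iH := word_in_face H.
rewrite (@eq_word_cup _ _ _ word_unit _ (word_of g)) //; last first.
  by move=> u us _; apply/word_of_unit/word_in_sub/us/iH.
case: (enum _) => [|x s /=]; first by rewrite word_of_nil.
have cup0 (y : seq 'I_k -> R) t : word_cup (fun=> 0) y t = 0.
  elim: t y => //= z t IH y; rewrite mul0r add0r -[RHS](IH (twist y)).
  exact: eq_word_cup.
rewrite {1}/word_unit /= mul1r (@eq_word_cup _ _ _ (fun=> 0) _ (twist (word_of g))) //.
  by rewrite cup0 addr0.
by move=> u _ u0; rewrite /prepend /word_unit /= eqSS size_eq0 (negbTE u0).
Qed.

Lemma cup_unitr f : cochain_op Cup f unit_cochain = f.
Proof.
apply/ffunP => H; rewrite ffunE /= -[RHS]word_of_face.
have iH := word_in_face H; have: enum (vertices H) != [::].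
  by rewrite -size_eq0 -cardE -lt0n face_gt0.
rewrite (@eq_word_cup _ _ _ (word_of f) _ word_unit) //; last first.
  by move=> u us _; apply/word_of_unit/word_in_sub/us/iH.
elim: (enum _) (word_of f) => //= x s IH h _.
rewrite {1}/word_unit; have [->|s0] /= := eqVneq s [::].
  by rewrite mulr1 addr0.
rewrite eqSS size_eq0 (negbTE s0) mulr0 add0r -[RHS](IH (prepend x h)) //.
apply: eq_word_cup => // u _ _; rewrite /twist /word_unit.
case: eqP => [->|_]; last by rewrite !mulr0.
by rewrite -signr_odd mul1r.
Qed.

Lemma op_coef_cop F G H :
  op_coef Cop F G H = (-1) ^+ (fdeg F * fdeg G) * op_coef Cup G F H.
Proof.
rewrite /op_coef [LHS]ffunE [X in _ = _ * X]ffunE /=.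
rewrite word_copE ?word_cupE; try exact: sorted_enum.
rewrite mulr_sumr; apply: eq_big_seq => v _; rewrite word_of_indicM.
have card_sub w : subseq w (enum (vertices H)) -> #|[set x in w]| = size w.
  by move=> /subseq_uniq/(_ (enum_uniq _))/card_uniqP <-; rewrite cardsE.
case: eqP => [vG|_]; last by rewrite mul0r !mulr0.
case: eqP => [vF|_]; last by rewrite !mulr0.
rewrite -(card_sub _ (filter_subseq _ _)) -(card_sub (from _ _) (filter_subseq _ _)).
rewrite vF vG mulrA -exprD [(_ * _.-1)%N]mulnC addnn.
by rewrite -muln2 exprM sqrr_sign !mul1r.
Qed.

End Coefficients.

(** The coefficients only depend on the relative position of the vertices; this
    is what makes the operations natural. *)
Lemma op_coef_map (R : comPzRingType) (k l : nat) (A : {set 'I_k})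
    (B : {set 'I_l}) (h : 'I_k -> 'I_l) o (F G H : face A) (F' G' H' : face B) :
  (forall x y : 'I_k, (x < y)%N -> (h x < h y)%N) ->
  vertices F' = h @: vertices F -> vertices G' = h @: vertices G ->
  vertices H' = h @: vertices H ->
  op_coef R o F' G' H' = op_coef R o F G H.
Proof.
move=> hmono eF eG eH.
have hinj : injective h.
  move=> x y exy; apply/val_inj; have [/hmono|/hmono|//] := ltngtP x y;
  by rewrite exy ltnn.
rewrite /op_coef !ffunE eH enum_imset // word_eval_map.
have indicE (K : face A) (K' : face B) u : vertices K' = h @: vertices K ->
    (word_of (indic R K') \o map h) u = word_of (indic R K) u.
  move=> eK; rewrite /= (word_of_indic R K) (word_of_indic R K') eK -(inj_eq (imset_inj hinj)).
  congr ((_ == _)%:R); apply/setP => x; rewrite inE; apply/mapP/imsetP => -[y yu ->].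
    by exists y; rewrite // inE.
  by exists y; rewrite // inE in yu *.
by apply: eq_word_eval => u _ _; exact: indicE.
Qed.

(** * Signed tensor products of kernels *)

Lemma bigA_distr_dffun (R : pzSemiRingType) (I : finType) (T : I -> finType)
    (F : forall i, T i -> R) :
  \sum_(f : {dffun forall i, T i}) \prod_i F i (f i) =
  \prod_i \sum_(x : T i) F i x.
Proof.
rewrite (reindex (@dffun_of_fprod _ T)); last first.
  exact/onW_bij/dffun_of_fprod_bij.
pose P i := [ffun x : T i => F i x].
transitivity (\sum_(t : fprod T) \prod_(i in I) P i (t i)).
  by apply: eq_bigr => t _; apply: eq_bigr => i _; rewrite !ffunE.
rewrite big_fprod -(bigA_distr_big_dep _ (fun i j => untag 0 (P i) j)).
apply: eq_bigr => i _.
by rewrite -(big_tag P); apply: eq_bigr => x _; rewrite ffunE.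
Qed.

(** Composition rules for operations given by kernels; they reduce identities
    between operations to identities between kernels. *)
Section BilinearKernels.
Variables (R : comPzRingType) (W : finType).
Implicit Types (w e z s : W -> R) (t : W -> W -> R) (u : W -> W -> W -> R).

Definition act1 t w (D : W) : R := \sum_B w B * t B D.
Definition act2 u w e (D : W) : R := \sum_B \sum_C w B * e C * u B C D.

Lemma eq_act1 t w w' D : w =1 w' -> act1 t w D = act1 t w' D.
Proof. by move=> ww; apply: eq_bigr => B _; rewrite ww. Qed.

Lemma eq_act2 u w w' e e' D : w =1 w' -> e =1 e' -> act2 u w e D = act2 u w' e' D.
Proof.
by move=> ww ee; apply: eq_bigr => B _; apply: eq_bigr => C _; rewrite ww ee.
Qed.

Lemma act2_linearl u a w w' e D :
  act2 u (fun B => a * w B + w' B) e D = a * act2 u w e D + act2 u w' e D.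
Proof.
rewrite /act2 mulr_sumr -big_split; apply: eq_bigr => B _ /=.
by rewrite mulr_sumr -big_split; apply: eq_bigr => C _ /=; ring.
Qed.

Lemma act2_linearr u a w e e' D :
  act2 u w (fun B => a * e B + e' B) D = a * act2 u w e D + act2 u w e' D.
Proof.
rewrite /act2 mulr_sumr -big_split; apply: eq_bigr => B _ /=.
by rewrite mulr_sumr -big_split; apply: eq_bigr => C _ /=; ring.
Qed.

Lemma act1_act2 t u w e D :
  act1 t (act2 u w e) D =
  \sum_B \sum_C w B * e C * \sum_D' u B C D' * t D' D.
Proof.
rewrite /act1 /act2; under eq_bigr do rewrite mulr_suml.
rewrite exchange_big /=; apply: eq_bigr => B _.
under eq_bigr do rewrite mulr_suml.
rewrite exchange_big /=; apply: eq_bigr => C _.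
by rewrite mulr_sumr; apply: eq_bigr => D' _; rewrite mulrA.
Qed.

Lemma act2_act1l t u w e D :
  act2 u (act1 t w) e D =
  \sum_B \sum_C w B * e C * \sum_B' t B B' * u B' C D.
Proof.
rewrite /act2 /act1 exchange_big [in RHS]exchange_big /=.
apply: eq_bigr => C _; under eq_bigr do rewrite !mulr_suml.
rewrite exchange_big /=; apply: eq_bigr => B _.
by rewrite mulr_sumr; apply: eq_bigr => B' _; ring.
Qed.

Lemma act2_act1r t u s w e D :
  act2 u (fun B => s B * w B) (act1 t e) D =
  \sum_B \sum_C w B * e C * (s B * \sum_C' t C C' * u B C' D).
Proof.
rewrite /act2 /act1; apply: eq_bigr => B _.
under eq_bigr do rewrite mulr_sumr mulr_suml.
rewrite exchange_big /=; apply: eq_bigr => C _.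
by rewrite !mulr_sumr; apply: eq_bigr => C' _; ring.
Qed.

Lemma act2_act2l u w e z D :
  act2 u (act2 u w e) z D =
  \sum_B \sum_C \sum_E w B * e C * z E * \sum_D' u B C D' * u D' E D.
Proof.
rewrite /act2.
transitivity (\sum_D' \sum_B \sum_C \sum_E
    w B * e C * z E * (u B C D' * u D' E D)).
  apply: eq_bigr => D' _; under eq_bigr do rewrite !mulr_suml.
  rewrite exchange_big /=; apply: eq_bigr => B _.
  under eq_bigr do rewrite !mulr_suml.
  rewrite exchange_big /=; apply: eq_bigr => C _; apply: eq_bigr => E _; ring.
rewrite exchange_big /=; apply: eq_bigr => B _.
rewrite exchange_big /=; apply: eq_bigr => C _.
by rewrite exchange_big /=; apply: eq_bigr => E _; rewrite mulr_sumr.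
Qed.

Lemma act2_act2r u w e z D :
  act2 u w (act2 u e z) D =
  \sum_B \sum_C \sum_E w B * e C * z E * \sum_D' u C E D' * u B D' D.
Proof.
rewrite /act2; apply: eq_bigr => B _.
transitivity (\sum_D' \sum_C \sum_E
    w B * e C * z E * (u C E D' * u B D' D)).
  apply: eq_bigr => D' _; rewrite mulr_sumr mulr_suml; apply: eq_bigr => C _.
  by rewrite mulr_sumr mulr_suml; apply: eq_bigr => E _; ring.
rewrite exchange_big /=; apply: eq_bigr => C _.
by rewrite exchange_big /=; apply: eq_bigr => E _; rewrite mulr_sumr.
Qed.

Lemma act2_neq0 u w e D : act2 u w e D != 0 ->
  exists B C, [/\ w B != 0, e C != 0 & u B C D != 0].
Proof.
move=> nz; have /existsP[B /existsP[C /and3P[]]] :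
    [exists B, exists C, [&& w B != 0, e C != 0 & u B C D != 0]]; last by exists B, C.
apply: contraNT nz; rewrite negb_exists => /forallP noB; apply/eqP.
apply: big1 => B _; apply: big1 => C _; have := noB B.
rewrite negb_exists => /forallP/(_ C); rewrite !negb_and !negbK.
by case/or3P => /eqP ->; rewrite !(mul0r, mulr0).
Qed.

(** Pullback along an injection h whose image contains the support of the
    kernel over the image points. *)
Lemma act2_reindex (W' : finType) (h : W' -> W) u
    (u' : W' -> W' -> W' -> R) w e D :
  injective h ->
  (forall B C, u B C (h D) != 0 -> B \in codom h /\ C \in codom h) ->
  (forall B C, u (h B) (h C) (h D) = u' B C D) ->
  act2 u w e (h D) = \sum_B \sum_C w (h B) * e (h C) * u' B C D.
Proof.
move=> hinj supp th; rewrite /act2.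
have sum_codom (F : W -> R) : (forall B, F B != 0 -> B \in codom h) ->
    \sum_B F B = \sum_B F (h B).
  move=> suppF; rewrite (bigID (mem (codom h))) /= [X in _ + X]big1 ?addr0; last first.
    by move=> B; apply: contraNeq; exact: suppF.
  rewrite -[RHS](big_map h predT F) [RHS]big_uniq /=; last first.
    by rewrite map_inj_uniq ?index_enum_uniq.
  apply: eq_bigl => B; apply/codomP/mapP => -[x]; last by exists x.
  by move=> ->; exists x; rewrite ?mem_index_enum.
rewrite sum_codom; last first.
  move=> B; apply: contraNT => nB; apply/eqP/big1 => C _.
  have [->|/supp[hB]] := eqVneq (u B C (h D)) 0; first by rewrite mulr0.
  by rewrite hB in nB.
apply: eq_bigr => B _; rewrite sum_codom; last first.
  move=> C; apply: contraNT => nC; apply/eqP.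
  have [->|/supp[_ hC]] := eqVneq (u (h B) C (h D)) 0; first by rewrite mulr0.
  by rewrite hC in nC.
by apply: eq_bigr => C _; rewrite th.
Qed.

End BilinearKernels.

Section Tensor.
Variables (R : comPzRingType) (n : nat) (T : 'I_n.+1 -> finType).
Variable deg : forall i, T i -> nat.
Local Notation W := {dffun forall i, T i}.
Local Notation kernel1 := (forall i, T i -> T i -> R).
Local Notation kernel2 := (forall i, T i -> T i -> T i -> R).
Implicit Types (d : kernel1) (th : kernel2) (B C D E : W) (t : 'I_n.+1 -> nat).

(** The sign of moving each factor of C past the later factors of B. *)
Definition koszul B C : R :=
  (-1) ^+ (\sum_(i : 'I_n.+1) \sum_(j : 'I_n.+1 | (j < i)%N)
             deg (B i) * deg (C j))%N.

(** The sign of moving an operation of degree 1 past the factors before i, of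
    degrees a. *)
Definition koszul_before (a : 'I_n.+1 -> nat) (i : 'I_n.+1) : R :=
  (-1) ^+ (\sum_(j : 'I_n.+1 | (j < i)%N) a j)%N.

Definition tensor2 th B C D : R :=
  koszul B C * \prod_i th i (B i) (C i) (D i).

Definition tensor1 d B D : R :=
  \sum_(i : 'I_n.+1) koszul_before (fun j => deg (B j)) i *
    \prod_j (if j == i then d j (B j) (D j) else (D j == B j)%:R).

Lemma koszul_beforeE a i :
  koszul_before a i = \prod_(j : 'I_n.+1) (if (j < i)%N then (-1) ^+ a j else 1).
Proof. by rewrite /koszul_before expr_sum big_mkcond. Qed.

Lemma koszul_beforeD a b i :
  koszul_before (fun j => a j + b j)%N i = koszul_before a i * koszul_before b i.
Proof. by rewrite /koszul_before big_split exprD. Qed.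

Definition graded1 d := forall i (F G : T i), d i F G != 0 -> deg G = (deg F).+1.

(** The local kernel at the factor i lowers degrees by [t i]. *)
Definition graded2 t th :=
  forall i (F G H : T i), th i F G H != 0 -> (deg F + deg G = deg H + t i)%N.

(** Kernels are only compared where all local coefficients are nonzero, where
    the grading hypotheses determine the signs. *)
Lemma prod_mul_congr (F : 'I_n.+1 -> R) (x y : R) :
  ((forall i, F i != 0) -> x = y) -> \prod_i F i * x = \prod_i F i * y.
Proof.
case: (boolP [forall i, F i != 0]) => [/forallP F0 ->//|].
rewrite negb_forall => /existsP[i]; rewrite negbK => /eqP Fi _.
by rewrite (bigD1 i) //= Fi !mul0r.
Qed.

(** The two composites of a local product with the coboundary: of its value,
    and of its arguments in the tensor square. *)
Definition d_after d th i (F G H : T i) : R :=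
  \sum_K th i F G K * d i K H.

Definition d_before d th i (F G H : T i) : R :=
  \sum_K d i F K * th i K G H + (-1) ^+ deg F * \sum_K d i G K * th i F K H.

(** The Kronecker symbols in [tensor1] leave one coboundary at the factor i,
    and the sum over D' of products becomes a product of sums. The sign counts
    the degrees of the values at the factors before i. *)
Lemma tensor2_then_tensor1 d th t B C D : graded2 t th ->
  \sum_D' tensor2 th B C D' * tensor1 d D' D =
  koszul B C * \sum_i koszul_before (fun j => deg (B j) + deg (C j) + t j)%N i *
    \prod_j (if j == i then d_after d th (B j) (C j) (D j)
             else th j (B j) (C j) (D j)).
Proof.
move=> gth.
rewrite /tensor2 /tensor1; under eq_bigr do rewrite -mulrA mulr_sumr.
rewrite -mulr_sumr exchange_big /=; congr (_ * _); apply: eq_bigr => i _.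
under eq_bigr => D' _.
  rewrite koszul_beforeE mulrA -!big_split /=; over.
rewrite (bigA_distr_dffun (fun j (K : T j) => th j (B j) (C j) K *
  (if (j < i)%N then (-1) ^+ deg K else 1) *
  (if j == i then d j K (D j) else (D j == K)%:R))) koszul_beforeE -big_split.
apply: eq_bigr => j _ /=; have [->|ji] := eqVneq j i.
  by rewrite ltnn mul1r; apply: eq_bigr => K _; rewrite mulr1.
rewrite (bigD1 (D j)) //= eqxx mulr1 big1 ?addr0 => [|K KD]; last first.
  by rewrite eq_sym (negbTE KD) mulr0.
rewrite mulrC; case: ifP => // _.
have [->|/gth e] := eqVneq (th j (B j) (C j) (D j)) 0; first by rewrite !mulr0.
by rewrite e -addnA addnn exprD -signr_odd -[(-1) ^+ (t j).*2]signr_odd odd_double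
  signr_odd mulr1.
Qed.

Lemma koszul_stepl i B B' C : (forall j, j != i -> B' j = B j) ->
  deg (B' i) = (deg (B i)).+1 ->
  koszul B' C = koszul B C * koszul_before (fun j => deg (C j)) i.
Proof.
move=> eB dB; rewrite /koszul /koszul_before -exprD; congr (_ ^+ _).
rewrite (bigD1 i) //= [in RHS](bigD1 i) //= dB.
under eq_bigr do rewrite mulSn.
rewrite big_split /= -addnA addnC; congr (_ + _ + _)%N.
by apply: eq_bigr => j ji; rewrite eB.
Qed.

(** Raising the degree of C at i costs the degrees of B after i; multiplied by
    the total sign of B, this leaves the degrees of B up to i. *)
Lemma koszul_stepr i B C C' : (forall j, j != i -> C' j = C j) ->
  deg (C' i) = (deg (C i)).+1 ->
  koszul B C' * (-1) ^+ (\sum_j deg (B j))%N =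
  koszul B C * (koszul_before (fun j => deg (B j)) i * (-1) ^+ deg (B i)).
Proof.
move=> eC dC.
have -> : koszul B C' =
    koszul B C * (-1) ^+ (\sum_(j : 'I_n.+1 | (i < j)%N) deg (B j))%N.
  rewrite /koszul -exprD; congr (_ ^+ _).
  rewrite (big_mkcond (fun j : 'I_n.+1 => i < j)%N) -big_split /=.
  apply: eq_bigr => j _; have [ij|ij] := ltnP i j; last first.
    rewrite addn0; apply: eq_bigr => l lj; rewrite eC //.
    by apply: contraTneq lj => ->; rewrite -leqNgt.
  rewrite (bigD1 i) //= [in RHS](bigD1 i) //= dC mulnS -!addnA addnC -addnA.
  congr (_ + _)%N; congr (_ + _)%N.
  by apply: eq_bigr => l /andP[_ li]; rewrite eC.
rewrite -mulrA; congr (_ * _); rewrite /koszul_before -!exprD.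
have -> : (\sum_j deg (B j) = \sum_(j : 'I_n.+1 | (j < i)%N) deg (B j) + deg (B i)
    + \sum_(j : 'I_n.+1 | (i < j)%N) deg (B j))%N.
  rewrite (bigID (fun j : 'I_n.+1 => j < i)%N) /= -addnA; congr (_ + _)%N.
  rewrite (bigD1 i) ?ltnn //=; congr (_ + _)%N; apply: eq_bigl => j.
  by rewrite -leqNgt ltn_neqAle andbC eq_sym.
by rewrite addnC -addnA addnn exprD -[(-1) ^+ _.*2]signr_odd odd_double mulr1.
Qed.

(** The coboundary at the factor i of B' or C' changes the Koszul sign, and this
    change together with the sign (-1)^|B| of the Leibniz rule gives the same
    prefactor for both arguments. *)
Lemma tensor1_then_tensor2 d th B C D : graded1 d ->
  \sum_B' tensor1 d B B' * tensor2 th B' C D +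
    (-1) ^+ (\sum_j deg (B j))%N * \sum_C' tensor1 d C C' * tensor2 th B C' D =
  koszul B C * \sum_i koszul_before (fun j => deg (B j) + deg (C j))%N i *
    \prod_j (if j == i then d_before d th (B j) (C j) (D j)
             else th j (B j) (C j) (D j)).
Proof.
move=> gd.
have left_sum : \sum_B' tensor1 d B B' * tensor2 th B' C D =
  koszul B C * \sum_i koszul_before (fun j => deg (B j) + deg (C j))%N i *
    \prod_j (if j == i then \sum_K d j (B j) K * th j K (C j) (D j)
             else th j (B j) (C j) (D j)).
  rewrite /tensor1 /tensor2; under eq_bigr do rewrite mulr_suml.
  rewrite exchange_big mulr_sumr /=; apply: eq_bigr => i _.
  rewrite koszul_beforeD !mulrA [koszul B C * _]mulrC -!mulrA.
  under eq_bigr do rewrite -mulrA.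
  rewrite -mulr_sumr; congr (_ * _).
  transitivity (\sum_(B' : W) (koszul B C * koszul_before (fun j => deg (C j)) i) *
    \prod_j ((if j == i then d j (B j) (B' j) else (B' j == B j)%:R) *
             th j (B' j) (C j) (D j))).
    apply: eq_bigr => B' _; rewrite big_split /= [RHS]mulrA [RHS]mulrC.
    rewrite mulrA [in LHS]mulrC; congr (_ * _).
    rewrite [RHS]mulrC; apply: prod_mul_congr => nz; apply: koszul_stepl.
      move=> j ji; have := nz j; rewrite (negbTE ji).
      by case: (B' j =P B j) => // _ /=; rewrite eqxx.
    by have := nz i; rewrite eqxx => /gd.
  rewrite -mulr_sumr mulrA; congr (_ * _).
  rewrite (bigA_distr_dffun (fun j (K : T j) =>
    (if j == i then d j (B j) K else (K == B j)%:R) * th j K (C j) (D j))).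
  apply: eq_bigr => j _; case: ifP => // _.
  rewrite (bigD1 (B j)) //= eqxx mul1r big1 ?addr0 // => K KB.
  by rewrite (negbTE KB) mul0r.
have right_sum : (-1) ^+ (\sum_j deg (B j))%N *
    \sum_C' tensor1 d C C' * tensor2 th B C' D =
  koszul B C * \sum_i koszul_before (fun j => deg (B j) + deg (C j))%N i *
    \prod_j (if j == i then (-1) ^+ deg (B j) *
                 \sum_K d j (C j) K * th j (B j) K (D j)
             else th j (B j) (C j) (D j)).
  rewrite /tensor1 /tensor2 (eq_bigr _ (fun C' _ => mulr_suml _ _ _ _)).
  rewrite exchange_big !mulr_sumr /=; apply: eq_bigr => i _.
  transitivity (\sum_(C' : W) koszul_before (fun j => deg (C j)) i *
    (koszul B C * (koszul_before (fun j => deg (B j)) i * (-1) ^+ deg (B i))) *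
    \prod_j ((if j == i then d j (C j) (C' j) else (C' j == C j)%:R) *
             th j (B j) (C' j) (D j))).
    rewrite mulr_sumr; apply: eq_bigr => C' _; rewrite big_split /=.
    set X := \prod_j (if _ then _ else _); set Y := \prod_j th _ _ _ _.
    transitivity (koszul_before (fun j => deg (C j)) i * Y *
      (X * (koszul B C' * (-1) ^+ (\sum_j deg (B j))))); first by ring.
    rewrite (_ : X * (koszul B C' * (-1) ^+ (\sum_j deg (B j))) =
      X * (koszul B C * (koszul_before (fun j => deg (B j)) i * (-1) ^+ deg (B i)))).
      by ring.
    apply: prod_mul_congr => nz; apply: koszul_stepr.
      move=> j ji; have := nz j; rewrite (negbTE ji).
      by case: (C' j =P C j) => // _ /=; rewrite eqxx.
    by have := nz i; rewrite eqxx => /gd.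
  rewrite -mulr_sumr koszul_beforeD (bigA_distr_dffun (fun j (K : T j) =>
    (if j == i then d j (C j) K else (K == C j)%:R) * th j (B j) K (D j))).
  rewrite (bigD1 i) //= [in RHS](bigD1 i) //= !eqxx.
  have -> : \prod_(j | j != i) \sum_K ((if j == i then d j (C j) K
      else (K == C j)%:R) * th j (B j) K (D j)) =
    \prod_(j | j != i) (if j == i then (-1) ^+ deg (B j) *
                 \sum_K d j (C j) K * th j (B j) K (D j)
             else th j (B j) (C j) (D j)).
    apply: eq_bigr => j ji; rewrite (negbTE ji).
    rewrite (bigD1 (C j)) //= eqxx mul1r big1 ?addr0 // => K KC.
    by rewrite (negbTE KC) mul0r.
  by ring.
rewrite left_sum right_sum -mulrDr -big_split /=; congr (_ * _).
apply: eq_bigr => i _; rewrite -mulrDr; congr (_ * _).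
rewrite (bigD1 i) //= [X in _ + X](bigD1 i) //= [RHS](bigD1 i) //= !eqxx.
rewrite /d_before mulrDl; congr (_ * _ + _ * _);
  by apply: eq_bigr => j /negbTE ->.
Qed.

Lemma tensor2_leibniz d th B C D : graded1 d -> graded2 (fun=> 0%N) th ->
  (forall i (F G H : T i), d_after d th F G H = d_before d th F G H) ->
  \sum_D' tensor2 th B C D' * tensor1 d D' D =
  \sum_B' tensor1 d B B' * tensor2 th B' C D +
    (-1) ^+ (\sum_j deg (B j))%N * \sum_C' tensor1 d C C' * tensor2 th B C' D.
Proof.
move=> gd gth dth; rewrite (tensor2_then_tensor1 _ _ _ _ gth).
rewrite tensor1_then_tensor2 //; congr (_ * _); apply: eq_bigr => i _.
congr (_ * _); last by apply: eq_bigr => j _; rewrite dth.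
by congr (_ ^+ _); apply: eq_bigr => j _; rewrite addn0.
Qed.

(** The Koszul sign is bimultiplicative and degrees add in each factor, so both
    sides carry the product of the signs of the pairs (B, C), (B, E), (C, E). *)
Lemma tensor2A th B C E D : graded2 (fun=> 0%N) th ->
  (forall i (F G K H : T i),
     \sum_L th i F G L * th i L K H = \sum_L th i G K L * th i F L H) ->
  \sum_D' tensor2 th B C D' * tensor2 th D' E D =
  \sum_D' tensor2 th C E D' * tensor2 th B D' D.
Proof.
move=> gth thA; rewrite /tensor2.
have koszulD B1 B2 E1 : (forall i, deg (B1 i) + deg (B2 i) = deg (E1 i))%N ->
    forall C1, koszul E1 C1 = koszul B1 C1 * koszul B2 C1.
  move=> e C1; rewrite /koszul -exprD; congr (_ ^+ _); rewrite -big_split /=.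
  apply: eq_bigr => i _; rewrite -big_split /=; apply: eq_bigr => j _.
  by rewrite -mulnDl e.
have koszulDr B1 B2 E1 : (forall i, deg (B1 i) + deg (B2 i) = deg (E1 i))%N ->
    forall C1, koszul C1 E1 = koszul C1 B1 * koszul C1 B2.
  move=> e C1; rewrite /koszul -exprD; congr (_ ^+ _); rewrite -big_split /=.
  apply: eq_bigr => i _; rewrite -big_split /=; apply: eq_bigr => j _.
  by rewrite -mulnDr e.
transitivity (\sum_(D' : W) koszul B C * (koszul B E * koszul C E) *
   \prod_i (th i (B i) (C i) (D' i) * th i (D' i) (E i) (D i))).
  apply: eq_bigr => D' _; rewrite big_split /=.
  set X := \prod_i th i (B i) _ _; set Y := \prod_i th i (D' i) _ _.
  transitivity (koszul B C * Y * (X * koszul D' E)); first by ring.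
  rewrite (_ : X * _ = X * (koszul B E * koszul C E)); first by ring.
  apply: prod_mul_congr => nz; apply: koszulD => i.
  by have /gth := nz i; rewrite addn0.
transitivity (\sum_(D' : W) koszul B C * (koszul B E * koszul C E) *
   \prod_i (th i (C i) (E i) (D' i) * th i (B i) (D' i) (D i))); last first.
  apply: eq_bigr => D' _; rewrite big_split /=.
  set X := \prod_i th i (C i) _ _; set Y := \prod_i th i (B i) _ _.
  transitivity (koszul C E * Y * (X * koszul B D')); last by ring.
  rewrite (_ : X * koszul B D' = X * (koszul B C * koszul B E)); first by ring.
  apply: prod_mul_congr => nz; apply: koszulDr => i.
  by have /gth := nz i; rewrite addn0.
rewrite -!mulr_sumr; congr (_ * _).
rewrite (bigA_distr_dffun (fun i (L : T i) =>
  th i (B i) (C i) L * th i L (E i) (D i))).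
rewrite (bigA_distr_dffun (fun i (L : T i) =>
  th i (C i) (E i) L * th i (B i) L (D i))).
by apply: eq_bigr => i _; exact: thA.
Qed.

(** The product of the total degrees splits into the pairs of factors with
    j < i, j = i and j > i. *)
Lemma koszul_swap B C :
  koszul B C * (-1) ^+ (\sum_i deg (B i) * deg (C i))%N =
  (-1) ^+ ((\sum_i deg (B i)) * (\sum_i deg (C i)))%N * koszul C B.
Proof.
have -> : ((\sum_i deg (B i)) * (\sum_i deg (C i)) =
  \sum_(i : 'I_n.+1) \sum_(j : 'I_n.+1 | (j < i)%N) deg (B i) * deg (C j)
  + \sum_i deg (B i) * deg (C i)
  + \sum_(i : 'I_n.+1) \sum_(j : 'I_n.+1 | (j < i)%N) deg (C i) * deg (B j))%N.
  rewrite big_distrl /=.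
  have -> : (\sum_(i : 'I_n.+1) \sum_(j : 'I_n.+1 | (j < i)%N) deg (C i) * deg (B j)
    = \sum_(i : 'I_n.+1) \sum_(j : 'I_n.+1 | (i < j)%N) deg (B i) * deg (C j))%N.
    rewrite (exchange_big_dep predT) //=; apply: eq_bigr => i _.
    by apply: eq_bigr => j _; rewrite mulnC.
  rewrite -!big_split; apply: eq_bigr => i _ /=.
  rewrite big_distrr /= (bigID (fun j : 'I_n.+1 => j < i)%N) /= -addnA.
  congr (_ + _)%N; rewrite (bigD1 i) ?ltnn //=; congr (_ + _)%N.
  by apply: eq_bigl => j; rewrite -leqNgt ltn_neqAle andbC eq_sym.
rewrite [in RHS]exprD exprD -mulrA -mulrA -expr2 sqrr_sign mulr1.
by [].
Qed.

(** The sign on the factors before a makes cop anticommute with the coboundary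
    there; it is the sign of moving an operation of degree -1 to the
    factor a. *)
Definition homotopy_slot (cup cop cup1 : kernel2) (a : 'I_n.+1) : kernel2 :=
  fun i F G H =>
    if (i < a)%N then (-1) ^+ (deg F + deg G)%N * cop i F G H
    else if i == a then cup1 i F G H else cup i F G H.

Lemma graded_homotopy_slot cup cop cup1 a :
  graded2 (fun=> 0%N) cup -> graded2 (fun=> 0%N) cop ->
  graded2 (fun=> 1%N) cup1 ->
  graded2 (fun i => (i == a : nat)) (homotopy_slot cup cop cup1 a).
Proof.
move=> gcup gcop gcup1 i F G H; rewrite /homotopy_slot.
have [ia|ia|ia] := ltngtP i a.
- rewrite -val_eqE (ltn_eqF ia) => nz; apply: gcop.
  by apply: contraNneq nz => ->; rewrite mulr0.
- by rewrite -val_eqE (gtn_eqF ia) => /gcup.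
- by have -> : (i == a) = true; [rewrite -val_eqE /= ia eqxx|exact: gcup1].
Qed.

(** Away from the factor a the local kernel commutes or anticommutes with the
    coboundary, and these terms of the two sums cancel; the term at a is given
    by the local homotopy formula, and the signs before a cancel the
    prefactor. *)
Lemma tensor2_homotopy_slot d cup cop cup1 a B C D :
  graded1 d -> graded2 (fun=> 0%N) cup -> graded2 (fun=> 0%N) cop ->
  graded2 (fun=> 1%N) cup1 ->
  (forall i (F G H : T i), d_after d cup F G H = d_before d cup F G H) ->
  (forall i (F G H : T i), d_after d cop F G H = d_before d cop F G H) ->
  (forall i (F G H : T i), d_after d cup1 F G H + d_before d cup1 F G H =
     cup i F G H - cop i F G H) ->
  let th := homotopy_slot cup cop cup1 a in
  \sum_D' tensor2 th B C D' * tensor1 d D' D +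
  (\sum_B' tensor1 d B B' * tensor2 th B' C D +
    (-1) ^+ (\sum_j deg (B j))%N * \sum_C' tensor1 d C C' * tensor2 th B C' D) =
  koszul B C *
   (\prod_(i : 'I_n.+1) (if (i < a)%N then cop i else cup i) (B i) (C i) (D i) -
    \prod_(i : 'I_n.+1) (if (i < a.+1)%N then cop i else cup i) (B i) (C i) (D i)).
Proof.
move=> gd gcup gcop gcup1 dcup dcop dcup1 th.
have gth : graded2 (fun i => (i == a : nat)) th by exact: graded_homotopy_slot.
rewrite (tensor2_then_tensor1 _ _ _ _ gth) tensor1_then_tensor2 // -mulrDr.
congr (_ * _); rewrite -big_split /=.
have th_lt i (F G H : T i) : (i < a)%N ->
    th i F G H = (-1) ^+ (deg F + deg G)%N * cop i F G H.
  by rewrite /th /homotopy_slot => ->.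
have th_gt (i : 'I_n.+1) : (a < i)%N -> th i = cup i.
  by move=> ai; rewrite /th /homotopy_slot ltnNge (ltnW ai) /= -val_eqE (gtn_eqF ai).
have th_eq : th a = cup1 a by rewrite /th /homotopy_slot ltnn eqxx.
have dth_lt i (F G H : T i) : (i < a)%N -> d_after d th F G H = - d_before d th F G H.
  move=> ia; rewrite /d_after /d_before.
  under eq_bigr do rewrite th_lt // -mulrA.
  rewrite -mulr_sumr -/(d_after d cop F G H) dcop /d_before.
  have -> : \sum_K d i F K * th i K G H =
     - (-1) ^+ (deg F + deg G)%N * \sum_K d i F K * cop i K G H.
    rewrite mulr_sumr; apply: eq_bigr => K _.
    have [->|/gd e] := eqVneq (d i F K) 0; first by rewrite !(mul0r, mulr0).
    by rewrite th_lt // e addSn exprS; ring.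
  have -> : \sum_K d i G K * th i F K H =
     - (-1) ^+ (deg F + deg G)%N * \sum_K d i G K * cop i F K H.
    rewrite mulr_sumr; apply: eq_bigr => K _.
    have [->|/gd e] := eqVneq (d i G K) 0; first by rewrite !(mul0r, mulr0).
    by rewrite th_lt // e addnS exprS; ring.
  by ring.
have dth_gt (i : 'I_n.+1) (F G H : T i) : (a < i)%N ->
    d_after d th F G H = d_before d th F G H.
  by move=> ai; rewrite /d_after /d_before th_gt //; exact: dcup.
rewrite (bigD1 a) //= [X in _ + X]big1 ?addr0; last first.
  move=> i ia; have [iltad|igta|/val_inj iea] := ltngtP i a; last first.
  - by case/eqP: ia.
  - rewrite (_ : koszul_before _ i = - koszul_before (fun j => deg (B j) + deg (C j))%N i).
      rewrite mulNr addrC -mulrBr (bigD1 i) //= [X in _ - X](bigD1 i) //= !eqxx dth_gt //.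
      rewrite (_ : \prod_(j | j != i) (if j == i then d_after _ _ _ _ _ else _) =
       \prod_(j | j != i) (if j == i then d_before d th (B j) (C j) (D j)
           else th j (B j) (C j) (D j))) ?subrr ?mulr0 //.
      by apply: eq_bigr => j /negbTE ->.
    rewrite /koszul_before big_split /= [X in (_ + X)%N](bigD1 a) //= eqxx.
    rewrite [X in (_ + (_ + X))%N]big1 => [|j /andP[_ /negbTE ->] //].
    by rewrite addn0 addn1 exprS mulN1r.
  - rewrite (_ : koszul_before _ i = koszul_before (fun j => deg (B j) + deg (C j))%N i).
      rewrite -mulrDr (bigD1 i) //= [X in _ + X](bigD1 i) //= !eqxx dth_lt //.
      rewrite mulNr (_ : \prod_(j | j != i) (if j == i then d_after _ _ _ _ _ else _) =
       \prod_(j | j != i) (if j == i then d_before d th (B j) (C j) (D j)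
           else th j (B j) (C j) (D j))) ?addNr ?mulr0 //.
      by apply: eq_bigr => j /negbTE ->.
    congr (_ ^+ _); apply: eq_bigr => j ji; rewrite -val_eqE.
    by rewrite (ltn_eqF (ltn_trans ji iltad)) addn0.
rewrite (_ : koszul_before _ a = koszul_before (fun j => deg (B j) + deg (C j))%N a); last first.
  congr (_ ^+ _); apply: eq_bigr => j ja; rewrite -val_eqE.
  by rewrite (ltn_eqF ja) addn0.
rewrite -mulrDr (bigD1 a) //= [X in _ + X](bigD1 a) //= !eqxx.
rewrite (_ : \prod_(j | j != a) (if j == a then d_after _ _ _ _ _ else _) =
       \prod_(j | j != a) th j (B j) (C j) (D j)); last first.
  by apply: eq_bigr => j /negbTE ->.
rewrite (_ : \prod_(j | j != a) (if j == a then d_before _ _ _ _ _ else _) =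
       \prod_(j | j != a) th j (B j) (C j) (D j)); last first.
  by apply: eq_bigr => j /negbTE ->.
rewrite -mulrDl /d_after /d_before th_eq -/(d_after d cup1 _ _ _).
rewrite -/(d_before d cup1 _ _ _) dcup1.
rewrite [X in _ = X - _](bigD1 a) //= [X in _ = _ - X](bigD1 a) //= ltnn ltnSn.
rewrite (_ : \prod_(j < n.+1 | j != a) (if (j < a.+1)%N then _ else _) _ _ _ =
  \prod_(j < n.+1 | j != a) (if (j < a)%N then cop j else cup j) (B j) (C j) (D j)); last first.
  by apply: eq_bigr => j ja; rewrite ltnS leq_eqVlt val_eqE (negbTE ja).
rewrite -mulrBl mulrCA; congr (_ * _).
rewrite koszul_beforeE (bigD1 a) //= ltnn mul1r -big_split /=.
apply: eq_bigr => j ja; case: ifP => jlta.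
  by rewrite th_lt // mulrA -exprD addnn -[(-1) ^+ _.*2]signr_odd odd_double mul1r.
rewrite mul1r th_gt // ltn_neqAle leqNgt jlta andbT eq_sym val_eqE //.
Qed.

Lemma tensor2_homotopy d cup cop cup1 B C D :
  graded1 d -> graded2 (fun=> 0%N) cup -> graded2 (fun=> 0%N) cop ->
  graded2 (fun=> 1%N) cup1 ->
  (forall i (F G H : T i), d_after d cup F G H = d_before d cup F G H) ->
  (forall i (F G H : T i), d_after d cop F G H = d_before d cop F G H) ->
  (forall i (F G H : T i), d_after d cup1 F G H + d_before d cup1 F G H =
     cup i F G H - cop i F G H) ->
  \sum_a (let th := homotopy_slot cup cop cup1 a in
  (\sum_D' tensor2 th B C D' * tensor1 d D' D +
  (\sum_B' tensor1 d B B' * tensor2 th B' C D +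
    (-1) ^+ (\sum_j deg (B j))%N * \sum_C' tensor1 d C C' * tensor2 th B C' D))) =
  tensor2 cup B C D - tensor2 cop B C D.
Proof.
move=> gd gcup gcop gcup1 dcup dcop dcup1.
rewrite (eq_bigr _ (fun a _ => @tensor2_homotopy_slot d cup cop cup1 a B C D
  gd gcup gcop gcup1 dcup dcop dcup1)).
rewrite -mulr_sumr /tensor2 -mulrBr; congr (_ * _).
pose P m := \prod_(i : 'I_n.+1) (if (i < m)%N then cop i else cup i) (B i) (C i) (D i).
have -> : \prod_i cup i (B i) (C i) (D i) = P 0%N by [].
have -> : \prod_i cop i (B i) (C i) (D i) = P n.+1.
  by apply: eq_bigr => i _; rewrite ltn_ord.
rewrite -(big_mkord predT (fun a => P a - P a.+1)) -[RHS]opprB.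
rewrite -(telescope_sumr P (leq0n n.+1)) -sumrN.
by apply: eq_bigr => a _; rewrite opprB.
Qed.

End Tensor.

(** * The local kernels of the blow-up *)

Section LocalKernels.
Variables (R : comPzRingType) (k : nat) (A : {set 'I_k}).
Implicit Types (F G H K L : face A) (f g : cochain R A).

Lemma indicE F G : indic R F G = (G == F)%:R.
Proof. exact: ffunE. Qed.

Definition cob_coef F H : R := coboundary (indic R F) H.

Lemma coboundary_coef f H : coboundary f H = \sum_K f K * cob_coef K H.
Proof.
rewrite /cob_coef ffunE.
under [RHS]eq_bigr do rewrite ffunE mulrN.
rewrite sumrN; congr (- _).
under [RHS]eq_bigr do rewrite mulr_sumr.
rewrite exchange_big; apply: eq_bigr => G _.
rewrite (bigD1 G) //= big1 ?addr0 => [|K KG].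
  rewrite indicE eqxx mulr1. by rewrite [RHS]mulrC mulrA.
by rewrite indicE eq_sym (negbTE KG) !mulr0.
Qed.

Lemma cob_coef_neq0 F G : cob_coef F G != 0 -> fdeg G = (fdeg F).+1.
Proof.
rewrite /cob_coef ffunE => nz.
have: simplex_boundary R G F != 0.
  apply: contraNneq nz => b0; rewrite oppr_eq0; apply/eqP/big1 => K _.
  rewrite indicE; have [->|_] := eqVneq K F; first by rewrite b0 mul0r mulr0.
  by rewrite !mulr0.
rewrite ffunE => {}nz.
have [v /andP[vG /eqP vF]] : exists v, (v \in vertices G) && (vertices F == vertices G :\ v).
  apply/existsP; apply: contraNT nz; rewrite negb_exists => /forallP none.
  by apply/eqP/big1 => v P; have := none v; rewrite P.
have := face_gt0 F; rewrite /fdeg [in RHS]vF vF [in LHS](cardsD1 v) vG.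
by rewrite add1n /=; case: #|_|.
Qed.

Lemma cochain_op_indicl o f G H :
  cochain_op o f (indic R G) H = \sum_L f L * op_coef R o L G H.
Proof.
rewrite {1}(cochain_indic_sum f) cochain_op_suml sum_ffunE.
by apply: eq_bigr => L _; rewrite ffunE.
Qed.

Lemma cochain_op_indicr o F g H :
  cochain_op o (indic R F) g H = \sum_L g L * op_coef R o F L H.
Proof.
rewrite {1}(cochain_indic_sum g) cochain_op_sumr sum_ffunE.
by apply: eq_bigr => L _; rewrite ffunE.
Qed.

Lemma signed_indic F : signed (indic R F) = (-1) ^+ fdeg F *: indic R F.
Proof.
apply/ffunP => G; rewrite ffunE [in RHS]ffunE -[RHS]/(_ * _) indicE.
by have [->|_] := eqVneq G F; rewrite ?mulr0.
Qed.

Lemma op_coef_after o F G H :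
  \sum_K op_coef R o F G K * cob_coef K H =
  coboundary (cochain_op o (indic R F) (indic R G)) H.
Proof. by rewrite [RHS]coboundary_coef. Qed.

Lemma op_coef_before o F G H :
  \sum_K cob_coef F K * op_coef R o K G H +
    (-1) ^+ fdeg F * \sum_K cob_coef G K * op_coef R o F K H =
  cochain_op o (coboundary (indic R F)) (indic R G) H +
  cochain_op o (signed (indic R F)) (coboundary (indic R G)) H.
Proof.
rewrite (cochain_op_indicl o (coboundary (indic R F))) signed_indic.
rewrite -[_ *: indic R F]addr0 -(scale0r (indic R F)) cochain_op_linearl scale0r addr0.
by rewrite [X in _ = _ + X]ffunE (cochain_op_indicr o F).
Qed.

Lemma op_coefA F G K H :
  \sum_L op_coef R Cup F G L * op_coef R Cup L K H =
  \sum_L op_coef R Cup G K L * op_coef R Cup F L H.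
Proof.
transitivity (cochain_op Cup (cochain_op Cup (indic R F) (indic R G)) (indic R K) H).
  by rewrite (cochain_op_indicl Cup (cochain_op Cup (indic R F) (indic R G)) K H).
by rewrite cochain_cupA (cochain_op_indicr Cup F).
Qed.

End LocalKernels.

(** * Operations on the blow-up of a simplex *)

Section BlowUpProducts.
Variables (R : comPzRingType) (n m : nat) (color : 'I_m.+1 -> 'I_n.+1).
Local Notation T := (fun i : 'I_n.+1 => face (factor_vertices color i) : finType).
Local Notation deg := (fun i (F : T i) => fdeg F).
Local Notation kernel2 := (forall i, T i -> T i -> T i -> R).
Implicit Types (w e : blowup R color) (B C D E : blow_face color) (th : kernel2).

Definition cob_kernel i (F G : T i) : R := cob_coef R F G.

Definition op_kernel o i (F G H : T i) : R := op_coef R o F G H.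

Definition blow_op th w e : blowup R color :=
  [ffun D => act2 (tensor2 deg th) w e D].

Definition blow_signed w : blowup R color :=
  [ffun B => (-1) ^+ blow_deg B * w B].

Lemma graded_cob_kernel : graded1 deg cob_kernel.
Proof. by move=> i F G; exact: cob_coef_neq0. Qed.

Lemma graded_op_kernel o : graded2 deg (fun=> degree_drop o) (op_kernel o).
Proof. by move=> i F G H /op_coef_neq0[]. Qed.

Lemma blow_coboundaryE w D :
  blow_coboundary w D = act1 (tensor1 deg cob_kernel) w D.
Proof.
rewrite /blow_coboundary sum_ffunE; apply: eq_bigr => B _.
rewrite ffunE; congr (_ * _); rewrite /blow_coboundary_indic sum_ffunE.
apply: eq_bigr => i _; rewrite ffunE; congr (_ * _).
rewrite ffunE; apply: eq_bigr => j _.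
by case: ifP => // _; rewrite indicE.
Qed.

Lemma blow_cupE w e : blow_cup w e = blow_op (op_kernel Cup) w e.
Proof.
apply/ffunP => D; rewrite /blow_cup [RHS]ffunE sum_ffunE; apply: eq_bigr => B _.
rewrite sum_ffunE; apply: eq_bigr => C _; rewrite ffunE; congr (_ * _).
rewrite ffunE; congr (_ * _); rewrite ffunE; apply: eq_bigr => i _.
by rewrite cup_indicE.
Qed.

Lemma cup_kernel_d i (F G H : T i) :
  d_after cob_kernel (op_kernel Cup) F G H =
  d_before deg cob_kernel (op_kernel Cup) F G H.
Proof.
rewrite /d_after /d_before [LHS]op_coef_after [RHS]op_coef_before.
by rewrite coboundary_cup ffunE.
Qed.

Lemma cop_kernel_d i (F G H : T i) :
  d_after cob_kernel (op_kernel Cop) F G H =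
  d_before deg cob_kernel (op_kernel Cop) F G H.
Proof.
rewrite /d_after /d_before [LHS]op_coef_after [RHS]op_coef_before.
by rewrite coboundary_cop ffunE.
Qed.

Lemma cup1_kernel_d i (F G H : T i) :
  d_after cob_kernel (op_kernel Cup1) F G H +
  d_before deg cob_kernel (op_kernel Cup1) F G H =
  op_kernel Cup F G H - op_kernel Cop F G H.
Proof.
rewrite /d_after /d_before [X in X + _]op_coef_after [X in _ + X]op_coef_before.
rewrite coboundary_cup1.
have cancel (x y z t : cochain R (factor_vertices color i)) :
    (x - y - z - t) H + (z H + t H) = x H - y H.
  have cancelR (a b c d : R) : a - b - c - d + (c + d) = a - b by ring.
  by rewrite !ffunE; exact: cancelR.
exact: cancel.
Qed.

Lemma blow_cob_op th w e D :
  blow_coboundary (blow_op th w e) D =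
  \sum_B \sum_C w B * e C *
    \sum_D' tensor2 deg th B C D' * tensor1 deg cob_kernel D' D.
Proof.
rewrite blow_coboundaryE -act1_act2; apply: eq_act1 => D'; exact: ffunE.
Qed.

Lemma blow_op_cobl th w e D :
  blow_op th (blow_coboundary w) e D =
  \sum_B \sum_C w B * e C *
    \sum_B' tensor1 deg cob_kernel B B' * tensor2 deg th B' C D.
Proof.
rewrite ffunE -act2_act1l; apply: eq_act2 => // B'; exact: blow_coboundaryE.
Qed.

Lemma blow_op_cobr th w e D :
  blow_op th (blow_signed w) (blow_coboundary e) D =
  \sum_B \sum_C w B * e C * ((-1) ^+ blow_deg B *
    \sum_C' tensor1 deg cob_kernel C C' * tensor2 deg th B C' D).
Proof.
rewrite ffunE -act2_act1r; apply: eq_act2 => B'; first exact: ffunE.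
exact: blow_coboundaryE.
Qed.

Lemma blow_leibniz w e :
  blow_coboundary (blow_cup w e) =
  blow_cup (blow_coboundary w) e + blow_cup (blow_signed w) (blow_coboundary e).
Proof.
rewrite !blow_cupE; apply/ffunP => D; rewrite blow_cob_op ffunE.
rewrite [X in _ = X + _]blow_op_cobl [X in _ = _ + X]blow_op_cobr -big_split.
apply: eq_bigr => B _; rewrite -big_split; apply: eq_bigr => C _.
rewrite /= -mulrDr; congr (_ * _); apply: tensor2_leibniz.
- exact: graded_cob_kernel.
- exact: graded_op_kernel.
- exact: cup_kernel_d.
Qed.

Lemma blow_cupA w e z :
  blow_cup (blow_cup w e) z = blow_cup w (blow_cup e z).
Proof.
rewrite !blow_cupE; apply/ffunP => D; rewrite [LHS]ffunE [RHS]ffunE.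
pose u := tensor2 deg (op_kernel Cup).
transitivity (act2 u (act2 u w e) z D).
  by apply: eq_act2 => // B; exact: ffunE.
transitivity (act2 u w (act2 u e z) D); last first.
  by apply: eq_act2 => // B; rewrite ffunE.
have uA B C E : \sum_D' u B C D' * u D' E D = \sum_D' u C E D' * u B D' D.
  apply: tensor2A; first exact: graded_op_kernel.
  by move=> i F G K H; exact: op_coefA.
rewrite act2_act2l act2_act2r; apply: eq_bigr => B _; apply: eq_bigr => C _.
apply: eq_bigr => E _.
exact: (congr1 (fun r : R => w B * e C * z E * r) (uA B C E)).
Qed.

Definition slot_kernel a : kernel2 :=
  homotopy_slot deg (op_kernel Cup) (op_kernel Cop) (op_kernel Cup1) a.

Definition blow_cup1 w e : blowup R color := \sum_a blow_op (slot_kernel a) w e.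

(** The cup-one product of the blow-up is a homotopy from the opposite product
    to the cup product. *)
Lemma blow_homotopy w e :
  blow_coboundary (blow_cup1 w e) + (blow_cup1 (blow_coboundary w) e
    + blow_cup1 (blow_signed w) (blow_coboundary e)) =
  blow_cup w e - blow_op (op_kernel Cop) w e.
Proof.
have cob_sum (x : 'I_n.+1 -> blowup R color) :
    blow_coboundary (\sum_a x a) = \sum_a blow_coboundary (x a).
  elim/big_rec2: _ => [|a y1 y2 _ <-].
    by rewrite /blow_coboundary big1 // => B _; rewrite ffunE scale0r.
  by have := blow_coboundary_linear 1 (x a) y2; rewrite !scale1r.
rewrite cob_sum /blow_cup1 -!big_split blow_cupE; apply/ffunP => D.
rewrite sum_ffunE.
have op_sub (x y : blowup R color) : (x - y) D = x D - y D by rewrite !ffunE.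
rewrite op_sub [X in _ = X - _]ffunE [X in _ = _ - X]ffunE.
transitivity (\sum_(a : 'I_n.+1) \sum_B \sum_C w B * e C *
  (\sum_D' tensor2 deg (slot_kernel a) B C D' * tensor1 deg cob_kernel D' D +
   (\sum_B' tensor1 deg cob_kernel B B' * tensor2 deg (slot_kernel a) B' C D +
    (-1) ^+ blow_deg B *
      \sum_C' tensor1 deg cob_kernel C C' * tensor2 deg (slot_kernel a) B C' D))).
  apply: eq_bigr => a _.
  have op_add (x y z : blowup R color) : (x + (y + z)) D = x D + (y D + z D).
    by rewrite !ffunE.
  rewrite [LHS]op_add blow_cob_op blow_op_cobl blow_op_cobr -!big_split.
  apply: eq_bigr => B _; rewrite /= -!big_split; apply: eq_bigr => C _.
  by rewrite /= !mulrDr.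
rewrite exchange_big /act2 -sumrB /=; apply: eq_bigr => B _.
rewrite exchange_big -sumrB /=; apply: eq_bigr => C _.
rewrite -mulr_sumr -mulrBr; congr (_ * _); apply: tensor2_homotopy.
- exact: graded_cob_kernel.
- exact: graded_op_kernel.
- exact: graded_op_kernel.
- exact: graded_op_kernel.
- exact: cup_kernel_d.
- exact: cop_kernel_d.
- exact: cup1_kernel_d.
Qed.

Lemma blow_copE k l w e : homogeneous k w -> homogeneous l e ->
  blow_op (op_kernel Cop) w e = (-1) ^+ (k * l) *: blow_cup e w.
Proof.
move=> hw he; rewrite blow_cupE; apply/ffunP => D.
rewrite ffunE [in RHS]ffunE [X in _ *: X]ffunE /act2 exchange_big.
rewrite -[RHS]/(_ * _) mulr_sumr; apply: eq_bigr => C _.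
rewrite mulr_sumr; apply: eq_bigr => B _ /=.
have [->|/hw <-] := eqVneq (w B) 0; first by rewrite !(mul0r, mulr0).
have [->|/he <-] := eqVneq (e C) 0; first by rewrite !(mul0r, mulr0).
have -> : tensor2 deg (op_kernel Cop) B C D =
  (-1) ^+ (blow_deg B * blow_deg C) * tensor2 deg (op_kernel Cup) C B D.
  rewrite /tensor2 mulrA -koszul_swap -mulrA; congr (_ * _).
  rewrite expr_sum -big_split; apply: eq_bigr => i _ /=.
  by rewrite /op_kernel (op_coef_cop R (B i)).
by rewrite [w B * e C]mulrC mulrCA.
Qed.

Definition blow_one : blowup R color := [ffun B => (blow_deg B == 0%N)%:R].

Lemma blow_oneE B : blow_one B = \prod_i unit_cochain R (factor_vertices color i) (B i).
Proof.
rewrite ffunE /blow_deg sum_nat_eq0.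
case: (boolP [forall i, _]) => [/forallP all0|].
  by rewrite big1 // => i _; rewrite ffunE (eqP (implyP (all0 i) isT)).
rewrite negb_forall => /existsP[i]; rewrite implyTb => ni.
by rewrite (bigD1 i) //= ffunE (negbTE ni) mul0r.
Qed.

Lemma koszul0l B C : blow_deg B = 0%N -> koszul R deg B C = 1.
Proof.
move=> /eqP; rewrite /blow_deg sum_nat_eq0 => /forallP B0.
rewrite /koszul big1 ?expr0 // => i _; rewrite big1 // => j _.
by rewrite (eqP (implyP (B0 i) isT)).
Qed.

Lemma koszul0r B C : blow_deg C = 0%N -> koszul R deg B C = 1.
Proof.
move=> /eqP; rewrite /blow_deg sum_nat_eq0 => /forallP C0.
rewrite /koszul big1 ?expr0 // => i _; rewrite big1 // => j _.
by rewrite (eqP (implyP (C0 j) isT)) muln0.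
Qed.

Lemma prod_delta B D : \prod_i ((D i == B i)%:R : R) = (D == B)%:R.
Proof.
have [->|DB] := eqVneq D B; first by rewrite big1 // => i _; rewrite eqxx.
have /existsP[i ni] : [exists i, D i != B i].
  apply: contraNT DB; rewrite negb_exists => /forallP e; apply/eqP/ffunP => i.
  by have := e i; rewrite negbK => /eqP.
by rewrite (bigD1 i) //= (negbTE ni) mul0r.
Qed.

(** The unit is a tensor product of units and has degree 0, so that no Koszul
    sign occurs. *)
Lemma blow_cup_onel e : blow_cup blow_one e = e.
Proof.
rewrite blow_cupE; apply/ffunP => D; rewrite ffunE /act2 exchange_big.
transitivity (\sum_(C : blow_face color) e C * (D == C)%:R : R); last first.
  rewrite (bigD1 D) //= eqxx mulr1 big1 ?addr0 // => C CD.
  by rewrite eq_sym (negbTE CD) mulr0.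
apply: eq_bigr => C _.
transitivity (e C * \sum_(B : blow_face color) \prod_i
   (unit_cochain R (factor_vertices color i) (B i) * op_kernel Cup (B i) (C i) (D i))).
  rewrite mulr_sumr; apply: eq_bigr => B _; rewrite big_split /= -blow_oneE.
  rewrite [blow_one B * e C]mulrC -mulrA; congr (_ * _).
  rewrite ffunE; case: eqP => [B0|_]; last by rewrite !mul0r.
  by rewrite /tensor2 koszul0l // !mul1r.
congr (_ * _).
rewrite (bigA_distr_dffun (fun i (K : T i) =>
  unit_cochain R (factor_vertices color i) K * op_kernel Cup K (C i) (D i))).
rewrite -prod_delta; apply: eq_bigr => i _.
rewrite -indicE -{1}(cup_unitl (indic R (C i))) cochain_op_indicl.
by [].
Qed.

Lemma blow_cup_oner w : blow_cup w blow_one = w.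
Proof.
rewrite blow_cupE; apply/ffunP => D; rewrite ffunE /act2.
transitivity (\sum_(B : blow_face color) w B * (D == B)%:R : R); last first.
  rewrite (bigD1 D) //= eqxx mulr1 big1 ?addr0 // => C CD.
  by rewrite eq_sym (negbTE CD) mulr0.
apply: eq_bigr => B _.
transitivity (w B * \sum_(C : blow_face color) \prod_i
   (unit_cochain R (factor_vertices color i) (C i) * op_kernel Cup (B i) (C i) (D i))).
  rewrite mulr_sumr; apply: eq_bigr => C _; rewrite big_split /= -blow_oneE.
  rewrite -mulrA; congr (_ * _).
  rewrite ffunE; case: eqP => [C0|_]; last by rewrite !mul0r.
  by rewrite /tensor2 koszul0r // !mul1r.
congr (_ * _).
rewrite (bigA_distr_dffun (fun i (K : T i) =>
  unit_cochain R (factor_vertices color i) K * op_kernel Cup (B i) K (D i))).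
rewrite -prod_delta; apply: eq_bigr => i _.
rewrite -indicE -{1}(cup_unitr (indic R (B i))) cochain_op_indicr.
by [].
Qed.

End BlowUpProducts.

(** * Degrees and perverse degrees of products *)

Section Supports.
Variables (R : comPzRingType) (n m : nat) (color : 'I_m.+1 -> 'I_n.+1).
Local Notation T := (fun i : 'I_n.+1 => face (factor_vertices color i) : finType).
Local Notation deg := (fun i (F : T i) => fdeg F).
Local Notation kernel2 := (forall i, T i -> T i -> T i -> R).
Implicit Types (w e : blowup R color) (B C D : blow_face color) (th : kernel2).

Definition covering th := forall i (F G H : T i), th i F G H != 0 ->
  vertices H = (vertices F :|: vertices G)%SET.

Lemma covering_op o : covering (op_kernel R (color := color) o).
Proof. by move=> i F G H /op_coef_neq0[]. Qed.

Lemma covering_slot a : covering (slot_kernel R (color := color) a).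
Proof.
move=> i F G H; rewrite /slot_kernel /homotopy_slot; case: ifP => _.
  move=> nz; apply: (@covering_op Cop i F G H).
  by apply: contraNneq nz => ->; rewrite mulr0.
by case: ifP => _; exact: covering_op.
Qed.

Lemma graded_slot a :
  graded2 deg (fun i => (i == a : nat)) (slot_kernel R (color := color) a).
Proof. by apply: graded_homotopy_slot; exact: graded_op_kernel. Qed.

Lemma tensor2_neq0 th B C D i : tensor2 deg th B C D != 0 ->
  th i (B i) (C i) (D i) != 0.
Proof.
apply: contraNneq => t0; rewrite /tensor2 (bigD1 i) //= t0.
by rewrite mul0r mulr0.
Qed.

Lemma blow_op_neq0 th w e D : blow_op th w e D != 0 ->
  exists B C, [/\ w B != 0, e C != 0 & forall i, th i (B i) (C i) (D i) != 0].
Proof.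
rewrite ffunE => /act2_neq0[B [C [wB eC t0]]]; exists B, C; split=> // i.
exact: tensor2_neq0 t0.
Qed.

Lemma homogeneous_op th t k l j w e : graded2 deg t th ->
  (k + l = j + \sum_i t i)%N -> homogeneous k w -> homogeneous l e ->
  homogeneous j (blow_op th w e).
Proof.
move=> gth kl hw he D /blow_op_neq0[B [C [/hw dB /he dC nz]]].
apply/(@addIn (\sum_i t i)%N); rewrite -kl -dB -dC /blow_deg -!big_split /=.
by apply: eq_bigr => i _; rewrite (gth _ _ _ _ (nz i)).
Qed.

(** The apex at the factor n - c is in D exactly when it is in B or in C. If it
    is in D, the norm of D is -oo, which is below everything; otherwise the norms
    of D, B and C are sums of degrees over the same factors. *)
Lemma norm_op th t c w e (x y : \bar int) : graded2 deg t th -> covering th ->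
  (blow_norm c w <= x)%O -> (blow_norm c e <= y)%O ->
  (blow_norm c (blow_op th w e) <= (x + y)%E)%O.
Proof.
move=> gth cth /blow_norm_leP wx /blow_norm_leP ey; apply/blow_norm_leP => D.
move=> /blow_op_neq0[B [C [/wx Bx /ey Cy nz]]].
apply: le_trans (leeD Bx Cy); rewrite /indic_norm.
have apexD : has_apex D (n - c) = has_apex B (n - c) || has_apex C (n - c).
  apply/existsP/orP => [[i /andP[ni]]|].
    rewrite (cth _ _ _ _ (nz i)) inE => /orP[iB|iC].
      by left; apply/existsP; exists i; rewrite ni.
    by right; apply/existsP; exists i; rewrite ni.
  move=> [] /existsP[i /andP[ni iP]]; exists i;
    by rewrite ni (cth _ _ _ _ (nz i)) inE iP ?orbT.
rewrite apexD; case: ifP => [_|/negbT]; first exact: leNye.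
rewrite negb_or => /andP[/negbTE -> /negbTE ->].
rewrite -EFinD lee_fin -PoszD lez_nat -big_split /=.
apply: leq_sum => i _; rewrite (gth _ _ _ _ (nz i)); exact: leq_addr.
Qed.

End Supports.

(** * Restriction to faces *)

Section Restriction.
Variables (R : comPzRingType) (n m : nat) (color : 'I_m.+2 -> 'I_n.+1).
Variable l : 'I_m.+2.
Local Notation T c := (fun i : 'I_n.+1 => face (factor_vertices c i) : finType).
Local Notation deg c := (fun i (F : T c i) => fdeg F).
Local Notation color' := (color \o lift l).

Lemma cone_lift_mono (x y : 'I_m.+2) :
  (x < y)%N -> (cone_lift l x < cone_lift l y)%N.
Proof.
rewrite /cone_lift; case: (unliftP ord_max y) => [v ->|->].
  case: (unliftP ord_max x) => [u ->|->].
    by rewrite !lift_max /= !ltnNge leq_bump2.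
  by rewrite lift_max ltnNge ltnW //= ltn_ord.
case: (unliftP ord_max x) => [u _ _|->]; last by rewrite ltnn.
by rewrite lift_max; exact: ltn_ord.
Qed.

Lemma cone_lift_inj : injective (cone_lift l).
Proof.
move=> x y exy; apply/val_inj.
by have [/cone_lift_mono|/cone_lift_mono|//] := ltngtP x y; rewrite exy ltnn.
Qed.

Lemma fdeg_push i (F : T color' i) : fdeg (push_factor F) = fdeg F.
Proof.
by rewrite /fdeg /vertices /push_factor SubK card_imset //; exact: cone_lift_inj.
Qed.

Lemma op_kernel_push o i (F G H : T color' i) :
  op_kernel R o (push_factor F) (push_factor G) (push_factor H) =
  op_kernel R o F G H.
Proof.
by apply: (@op_coef_map _ _ _ _ _ (cone_lift l)) => //; exact: cone_lift_mono.
Qed.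

Lemma slot_kernel_push a i (F G H : T color' i) :
  slot_kernel R a (push_factor F) (push_factor G) (push_factor H) =
  slot_kernel R a F G H.
Proof.
by rewrite /slot_kernel /homotopy_slot !op_kernel_push (fdeg_push F) (fdeg_push G).
Qed.

Lemma push_factor_inj i : injective (@push_factor n m color l i).
Proof.
move=> F G /(congr1 (@vertices _ _)); rewrite /vertices !SubK => FG.
by apply/val_inj/(imset_inj cone_lift_inj).
Qed.

Lemma push_face_inj : injective (@push_face n m color l).
Proof.
move=> B C /ffunP BC; apply/ffunP => i; have := BC i; rewrite !ffunE.
exact: push_factor_inj.
Qed.

Lemma push_factor_sub i (F : T color' i) (G : T color i) :
  vertices G \subset vertices (push_factor F) ->
  exists G' : T color' i, G = push_factor G'.
Proof.
rewrite {1}/vertices /= => sGF.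
pose S := (cone_lift l @^-1: vertices G)%SET.
have GS : (cone_lift l @: S)%SET = vertices G.
  apply/setP => x; apply/imsetP/idP => [[y + ->]|xG]; first by rewrite inE.
  have /imsetP[y _ xy] := fintype.subsetP sGF _ xG.
  by exists y; rewrite // inE -xy.
have PS : (0 < #|S|)%N && (S \subset factor_vertices color' i).
  have := face_gt0 G; rewrite -GS card_imset => [-> /=|]; last exact: cone_lift_inj.
  apply/fintype.subsetP => y yS.
  have /imsetP[z zF /cone_lift_inj ->] : cone_lift l y \in (cone_lift l @: vertices F)%SET.
    by apply: (fintype.subsetP sGF); rewrite inE in yS.
  exact: (fintype.subsetP (face_sub F)).
exists (Sub S PS); apply/val_inj; rewrite /push_factor SubK /vertices SubK.
by rewrite GS.
Qed.

Lemma codom_push_face (B : blow_face color) (D : blow_face color') :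
  (forall i, vertices (B i) \subset vertices (push_face D i)) ->
  B \in codom (@push_face n m color l).
Proof.
move=> sBD.
have /fin_all_exists[f Bf] : forall i, exists G : T color' i, B i = push_factor G.
  move=> i; apply: (@push_factor_sub _ (D i)).
  by have := sBD i; rewrite ffunE.
by apply/codomP; exists (finfun f); apply/ffunP => i; rewrite !ffunE.
Qed.

(** The faces B and C that contribute to the value at a face D of the smaller
    simplex lie in D, hence come from the smaller simplex. *)
Lemma restrict_op (th : forall i, T color i -> T color i -> T color i -> R)
    (th' : forall i, T color' i -> T color' i -> T color' i -> R)
    (w e : blowup R color) : covering th ->
  (forall i (F G H : T color' i),
     th i (push_factor F) (push_factor G) (push_factor H) = th' i F G H) ->
  blow_restrict l (blow_op th w e) =
  blow_op th' (blow_restrict l w) (blow_restrict l e).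
Proof.
move=> cth thth'; apply/ffunP => D; rewrite [LHS]ffunE [LHS]ffunE [RHS]ffunE.
rewrite (@act2_reindex _ _ _ _ _ (tensor2 (deg color') th') _ _ _ push_face_inj).
- apply: eq_bigr => B _; apply: eq_bigr => C _.
  by congr (_ * _ * _); rewrite [RHS]ffunE.
- move=> B C nz; split; apply: (@codom_push_face _ D) => i;
    by rewrite (cth _ _ _ _ (tensor2_neq0 i nz)) ?finset.subsetUl ?finset.subsetUr.
- move=> B C; rewrite /tensor2; congr (_ * _).
    congr (_ ^+ _); apply: eq_bigr => i _; apply: eq_bigr => j _.
    by rewrite !ffunE (fdeg_push (B i)) (fdeg_push (C j)).
  by apply: eq_bigr => i _; rewrite !ffunE thth'.
Qed.

End Restriction.

(** * Cup and cup-one products of blow-up cochains *)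

Section BlowUpLinearity.
Variables (R : comPzRingType) (n m : nat) (color : 'I_m.+1 -> 'I_n.+1).
Implicit Types (w e : blowup R color).

Lemma blow_linearE a w e B : (a *: w + e) B = a * w B + e B.
Proof. by rewrite !ffunE. Qed.

Lemma blow_cup_linearl a w w' e :
  blow_cup (a *: w + w') e = a *: blow_cup w e + blow_cup w' e.
Proof.
apply/ffunP => D; rewrite blow_linearE !blow_cupE [LHS]ffunE.
rewrite [X in _ = _ * X + _]ffunE [X in _ = _ + X]ffunE -act2_linearl.
by apply: eq_act2 => // B; exact: blow_linearE.
Qed.

Lemma blow_cup_linearr a w e e' :
  blow_cup w (a *: e + e') = a *: blow_cup w e + blow_cup w e'.
Proof.
apply/ffunP => D; rewrite blow_linearE !blow_cupE [LHS]ffunE.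
rewrite [X in _ = _ * X + _]ffunE [X in _ = _ + X]ffunE -act2_linearr.
by apply: eq_act2 => // B; exact: blow_linearE.
Qed.

Lemma blow_op0l th e : blow_op th (0 : blowup R color) e = 0.
Proof.
apply/ffunP => D; rewrite !ffunE /act2 big1 // => B _; rewrite big1 // => C _.
by rewrite ffunE !mul0r.
Qed.

Lemma blow_op0r th w : blow_op th w (0 : blowup R color) = 0.
Proof.
apply/ffunP => D; rewrite !ffunE /act2 big1 // => B _; rewrite big1 // => C _.
by rewrite ffunE mulr0 mul0r.
Qed.

Lemma blow_cup0l e : blow_cup (0 : blowup R color) e = 0.
Proof. by rewrite blow_cupE blow_op0l. Qed.

Lemma blow_cup0r w : blow_cup w (0 : blowup R color) = 0.
Proof. by rewrite blow_cupE blow_op0r. Qed.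

Lemma blow_cup1_0l e : blow_cup1 (0 : blowup R color) e = 0.
Proof. by rewrite /blow_cup1 big1 // => a _; exact: blow_op0l. Qed.

Lemma blow_cup1_0r w : blow_cup1 w (0 : blowup R color) = 0.
Proof. by rewrite /blow_cup1 big1 // => a _; exact: blow_op0r. Qed.

Lemma blow_signedE k w : homogeneous k w -> blow_signed w = (-1) ^+ k *: w.
Proof.
move=> hw; apply/ffunP => B; rewrite [LHS]ffunE [RHS]ffunE.
have [->|/hw -> //] := eqVneq (w B) 0; by rewrite mulr0 scaler0.
Qed.

Lemma homogeneous0 k : homogeneous k (0 : blowup R color).
Proof. by move=> B; rewrite ffunE eqxx. Qed.

Lemma homogeneous_cup k l w e : homogeneous k w -> homogeneous l e ->
  homogeneous (k + l) (blow_cup w e).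
Proof.
rewrite blow_cupE; apply: (homogeneous_op (@graded_op_kernel _ _ _ _ Cup)).
by rewrite /= big1 ?addn0.
Qed.

Lemma homogeneous_cup1 k l j w e : (k + l = j.+1)%N ->
  homogeneous k w -> homogeneous l e -> homogeneous j (blow_cup1 w e).
Proof.
move=> kl hw he; rewrite /blow_cup1; elim/big_rec: _ => [|a x _ hx].
  exact: homogeneous0.
rewrite -[blow_op _ _ _]scale1r; apply: homogeneousP => //.
apply: (homogeneous_op (@graded_slot _ _ _ _ a) _ hw he).
by rewrite kl -addn1 (bigD1 a) //= eqxx big1 // => i /negbTE ->.
Qed.

(** A product lowering degrees by one has no value in degree -1. *)
Lemma blow_cup1_deg0 w e : homogeneous 0 w -> homogeneous 0 e -> blow_cup1 w e = 0.
Proof.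
move=> hw he; rewrite /blow_cup1 big1 // => a _; apply/ffunP => D.
rewrite [RHS]ffunE; apply/eqP/negPn/negP => /blow_op_neq0[B [C [/hw B0 /he C0 nz]]].
have /eqP := B0; rewrite /blow_deg sum_nat_eq0 => /forallP/(_ a)/eqP Ba.
have /eqP := C0; rewrite /blow_deg sum_nat_eq0 => /forallP/(_ a)/eqP Ca.
by have := graded_slot (nz a); rewrite eqxx Ba Ca addn1.
Qed.

Lemma norm_cup c w e (x y : \bar int) :
  (blow_norm c w <= x)%O -> (blow_norm c e <= y)%O ->
  (blow_norm c (blow_cup w e) <= (x + y)%E)%O.
Proof.
rewrite blow_cupE; apply: norm_op; first exact: graded_op_kernel.
exact: covering_op.
Qed.

Lemma norm_cup1 c w e (x y : \bar int) :
  (blow_norm c w <= x)%O -> (blow_norm c e <= y)%O ->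
  (blow_norm c (blow_cup1 w e) <= (x + y)%E)%O.
Proof.
move=> wx ey; rewrite /blow_cup1; elim/big_rec: _ => [|a z _ hz].
  by apply/blow_norm_leP => B; rewrite ffunE eqxx.
rewrite -[blow_op _ _ _]scale1r; apply: blow_norm_le => //.
by apply: norm_op wx ey; [exact: graded_slot|exact: covering_slot].
Qed.

(** The Leibniz rule for 1 cup 1 = 1 reads d1 = d1 + d1. *)
Lemma coboundary_one : blow_coboundary (blow_one R color) = 0.
Proof.
have one0 : homogeneous 0 (blow_one R color).
  by move=> B; rewrite ffunE; case: (blow_deg B =P 0%N) => //= _; rewrite eqxx.
have := blow_leibniz (blow_one R color) (blow_one R color).
rewrite blow_cup_onel blow_cup_oner (blow_signedE one0) scale1r blow_cup_onel.
by move/eqP; rewrite -subr_eq0 opprD addrA subrr add0r oppr_eq0 => /eqP.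
Qed.

End BlowUpLinearity.

(** * Products of families and of their classes *)

Section Families.
Variables (K : realType) (R : comPzRingType) (X : filteredSpace).
Local Notation family := (Defs.family K R X).
Implicit Types (w e z : family) (p q r : perversity X).

Definition family_cup w e : family := fun m s => blow_cup (w m s) (e m s).
Definition family_cup1 w e : family := fun m s => blow_cup1 (w m s) (e m s).
Definition family_one : family := fun m s => blow_one R (color s).

Lemma family_cup_linearl a w w' e :
  family_cup (a *: w + w') e = a *: family_cup w e + family_cup w' e.
Proof. by apply: Defs.familyP => m s; exact: blow_cup_linearl. Qed.

Lemma family_cup_linearr a w e e' :
  family_cup w (a *: e + e') = a *: family_cup w e + family_cup w e'.
Proof. by apply: Defs.familyP => m s; exact: blow_cup_linearr. Qed.

Lemma family_cupBl w w' e :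
  family_cup (w - w') e = family_cup w e - family_cup w' e.
Proof. by rewrite addrC -scaleN1r family_cup_linearl scaleN1r addrC. Qed.

Lemma family_cupBr w e e' :
  family_cup w (e - e') = family_cup w e - family_cup w e'.
Proof. by rewrite addrC -scaleN1r family_cup_linearr scaleN1r addrC. Qed.

Lemma family_cup0l e : family_cup 0 e = 0.
Proof. by apply: Defs.familyP => m s; exact: blow_cup0l. Qed.

Lemma family_cup0r w : family_cup w 0 = 0.
Proof. by apply: Defs.familyP => m s; exact: blow_cup0r. Qed.

Lemma family_leibniz k w e : blown_up k w ->
  family_coboundary (family_cup w e) =
  (-1) ^+ k *: family_cup w (family_coboundary e) + family_cup (family_coboundary w) e.
Proof.
move=> [_ hw]; apply: Defs.familyP => m s.
rewrite -[LHS]/(blow_coboundary (blow_cup (w m s) (e m s))) blow_leibniz addrC.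
congr (_ + _); rewrite (blow_signedE (hw m s)).
by rewrite -[(-1) ^+ k *: w m s]addr0 blow_cup_linearl blow_cup0l addr0.
Qed.

Lemma allowable_mul p q w e z : allowable p w -> allowable q e ->
  (forall m (s : regular_simplex K X m) c (x y : \bar int),
     (blow_norm c (w m s) <= x)%O -> (blow_norm c (e m s) <= y)%O ->
     (blow_norm c (z m s) <= (x + y)%E)%O) ->
  allowable (pervD p q) z.
Proof.
move=> aw ae nz S sS; apply/ereal_int_supremum_le => d /= [m [s [sm ->]]].
move: (aw S sS) (ae S sS) => /ereal_int_supremum_le wS /ereal_int_supremum_le eS.
by apply: nz; [apply: wS|apply: eS]; exists m, s.
Qed.

Lemma allowable_cup p q w e : allowable p w -> allowable q e ->
  allowable (pervD p q) (family_cup w e).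
Proof. by move=> aw ae; apply: allowable_mul aw ae _ => m s c x y; exact: norm_cup. Qed.

Lemma allowable_cup1 p q w e : allowable p w -> allowable q e ->
  allowable (pervD p q) (family_cup1 w e).
Proof. by move=> aw ae; apply: allowable_mul aw ae _ => m s c x y; exact: norm_cup1. Qed.

Lemma blown_up_cup k l w e : blown_up k w -> blown_up l e ->
  blown_up (k + l) (family_cup w e).
Proof.
move=> [rw hw] [re he]; split=> [m s i hi|m s]; last first.
  by apply: homogeneous_cup; [exact: hw|exact: he].
rewrite /family_cup -rw -re !blow_cupE; apply: restrict_op; first exact: covering_op.
by move=> j F G H; exact: op_kernel_push.
Qed.

Lemma blown_up_cup1 k l j w e : (k + l = j.+1)%N ->
  blown_up k w -> blown_up l e -> blown_up j (family_cup1 w e).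
Proof.
move=> kl [rw hw] [re he]; split=> [m s i hi|m s]; last first.
  by apply: (homogeneous_cup1 kl); [exact: hw|exact: he].
rewrite /family_cup1 -rw -re /blow_cup1.
have -> (x : 'I_(fdim X).+1 -> blowup R (color s)) :
    blow_restrict i (\sum_a x a) = \sum_a blow_restrict i (x a).
  by apply/ffunP => B; rewrite ffunE !sum_ffunE; apply: eq_bigr => a _; rewrite ffunE.
apply: eq_bigr => a _; apply: restrict_op; first exact: covering_slot.
by move=> b F G H; exact: slot_kernel_push.
Qed.

Lemma blown_up_one : blown_up 0 family_one.
Proof.
split=> [m s i hi|m s B].
  apply/ffunP => B; rewrite !ffunE; congr ((_ == _)%:R).
  by apply: eq_bigr => j _; rewrite ffunE (fdeg_push (B j)).
by rewrite ffunE; case: (blow_deg B =P 0%N) => //= _; rewrite eqxx.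
Qed.

Lemma coboundary_family_one : family_coboundary family_one = 0.
Proof. by apply: Defs.familyP => m s; exact: coboundary_one. Qed.

Lemma allowable_one : allowable (perv0 X) family_one.
Proof.
move=> S sS; apply/ereal_int_supremum_le => d /= [m [s [sm ->]]].
apply/blow_norm_leP => B; rewrite ffunE; case: (blow_deg B =P 0%N) => [B0 _|_]; last first.
  by rewrite eqxx.
rewrite /indic_norm; case: ifP => _; first exact: leNye.
rewrite big1 // => i _; apply/eqP; have /eqP := B0.
by rewrite /blow_deg sum_nat_eq0 => /forallP/(_ i).
Qed.

Lemma icochainP p k w : reflect
  [/\ blown_up k w, allowable p w & allowable p (family_coboundary w)]
  (w \in @icochain_pred K R X p k).
Proof. by rewrite unfold_in; exact: asboolP. Qed.

Lemma icochain_cup p q k l w e :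
  w \in @icochain_pred K R X p k -> e \in @icochain_pred K R X q l ->
  family_cup w e \in @icochain_pred K R X (pervD p q) (k + l).
Proof.
move=> /icochainP[bw aw dw] /icochainP[be ae de]; apply/icochainP; split.
- exact: blown_up_cup.
- exact: allowable_cup.
- by rewrite (family_leibniz e bw); apply: allowable_le; exact: allowable_cup.
Qed.

Lemma icochain_one : family_one \in @icochain_pred K R X (perv0 X) 0.
Proof.
apply/icochainP; split; first exact: blown_up_one.
- exact: allowable_one.
- by rewrite coboundary_family_one; exact: allowable0.
Qed.

(** A form of the coboundary condition on families rather than on cocycles, in
    which degrees only need to be propositionally equal. *)
Definition is_coboundary p k w : Prop :=
  w = 0 \/ exists j e, [/\ k = j.+1, e \in @icochain_pred K R X p j &
                           w = family_coboundary e].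

Lemma icoboundaryP p k (w : icocycle K R p k) :
  w \in @icoboundary_pred K R X p k <-> is_coboundary p k (ival w).
Proof.
rewrite unfold_in; case: k w => [|j] w.
  split=> [/asboolP ->|[w0|[j [e []]//]]]; first by left.
  by apply/asboolP; do 2![apply: val_inj].
split=> [/asboolP[e we]|[w0|[i [e [[<-] ie we]]]]].
- by right; exists j, (ival e); split=> //; exact: ivalP.
- by apply/asboolP; exists 0; rewrite w0 linear0.
- by apply/asboolP; exists (ICochain ie).
Qed.

Lemma coclass_eqP p k (w e : icocycle K R p k) :
  coclass w = coclass e <-> is_coboundary p k (ival w - ival e).
Proof. by rewrite coclass_eq icoboundaryP. Qed.

Lemma coclass_cast p q k l (pq : p = q) (kl : k = l) (w : icocycle K R p k)
    (e : icocycle K R q l) :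
  is_coboundary q l (ival w - ival e) ->
  cast_cohomology pq kl (coclass w) = coclass e.
Proof.
by move: pq kl => pq kl; subst q l => we; rewrite /cast_cohomology /=; apply/coclass_eqP.
Qed.

Lemma coclass_linear p k a (w e : icocycle K R p k) :
  a *: coclass w + coclass e = coclass (a *: w + e).
Proof. by rewrite coclassD -cohomology_scaleE. Qed.

Lemma is_coboundary_cupl p q k l w e :
  is_coboundary p k w -> e \in @icochain_pred K R X q l ->
  family_coboundary e = 0 -> is_coboundary (pervD p q) (k + l) (family_cup w e).
Proof.
case=> [->|[j [x [-> ix ->]]]] ie de; first by left; rewrite family_cup0l.
right; exists (j + l)%N, (family_cup x e); split=> //; first exact: icochain_cup.
have /icochainP[bx _ _] := ix.
by rewrite (family_leibniz e bx) de family_cup0r scaler0 add0r.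
Qed.

Lemma is_coboundary_cupr p q k l w e :
  w \in @icochain_pred K R X p k -> family_coboundary w = 0 ->
  is_coboundary q l e -> is_coboundary (pervD p q) (k + l) (family_cup w e).
Proof.
move=> iw dw [->|[j [x [-> ix ->]]]]; first by left; rewrite family_cup0r.
right; exists (k + j)%N, ((-1) ^+ k *: family_cup w x); split.
- by rewrite addnS.
- by rewrite rpredZ // icochain_cup.
have /icochainP[bw _ _] := iw.
rewrite linearZ /= (family_leibniz x bw) dw family_cup0l addr0 scalerA.
by rewrite -expr2 sqrr_sign scale1r.
Qed.

(** By the homotopy formula the difference is the coboundary of w cup1 e. This
    family is allowable like a product, and its coboundary is allowable as a
    combination of the two products. *)
Lemma is_coboundary_cupC p q k l w e :
  w \in @icochain_pred K R X p k -> family_coboundary w = 0 ->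
  e \in @icochain_pred K R X q l -> family_coboundary e = 0 ->
  is_coboundary (pervD q p) (l + k)
    (family_cup w e - (-1) ^+ (k * l) *: family_cup e w).
Proof.
move=> /icochainP[bw aw _] dw /icochainP[be ae _] de.
have cobE : family_cup w e - (-1) ^+ (k * l) *: family_cup e w =
    family_coboundary (family_cup1 w e).
  apply: Defs.familyP => m s; have [[_ hw] [_ he]] := (bw, be).
  have := blow_homotopy (w m s) (e m s).
  rewrite (blow_copE (hw m s) (he m s)).
  have -> : blow_coboundary (w m s) = 0 by have /(congr1 (fun f => f m s)) := dw.
  have -> : blow_coboundary (e m s) = 0 by have /(congr1 (fun f => f m s)) := de.
  by rewrite blow_cup1_0l blow_cup1_0r !addr0.
case kl : (l + k)%N => [|j].
  left; rewrite cobE; move: kl bw be => /eqP; rewrite addn_eq0 => /andP[/eqP -> /eqP ->].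
  move=> [_ hw] [_ he].
  rewrite (_ : family_cup1 w e = 0) ?linear0 //.
  by apply: Defs.familyP => m s; apply: blow_cup1_deg0.
right; exists j, (family_cup1 w e); split=> //; apply/icochainP; split.
- by apply: (blown_up_cup1 _ bw be); rewrite addnC.
- by rewrite pervDC; exact: allowable_cup1.
- rewrite -cobE pervDC addrC -scaleNr.
  by apply: allowable_le; [rewrite pervDC|]; exact: allowable_cup.
Qed.

End Families.

Section CupProduct.
Variables (K : realType) (R : comPzRingType) (X : filteredSpace).
Implicit Types p q : perversity X.

Definition cup_cochain p q k l (w : icochain K R p k) (e : icochain K R q l) :
  icochain K R (pervD p q) (k + l) := ICochain (icochain_cup (ivalP w) (ivalP e)).

Lemma icocycle0 p k (w : icocycle K R p k) : family_coboundary (ival w) = 0.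
Proof. exact: (eqP (cvalP w)). Qed.

Fact cup_cocycle_subproof p q k l (w : icocycle K R p k) (e : icocycle K R q l) :
  cup_cochain (cval w) (cval e) \in @icocycle_pred K R X (pervD p q) (k + l).
Proof.
have /icochainP[bw _ _] := ivalP w.
rewrite unfold_in; apply/eqP; rewrite /= (family_leibniz _ bw) !icocycle0.
by rewrite family_cup0r family_cup0l scaler0 addr0.
Qed.

Definition cup_cocycle p q k l (w : icocycle K R p k) (e : icocycle K R q l) :=
  ICocycle (cup_cocycle_subproof w e).

(** Defined on representatives; [cup_classE] shows that they do not matter. *)
Definition cup_class p q k l (x : cohomology K R p k) (y : cohomology K R q l) :
  cohomology K R (pervD p q) (k + l) := coclass (cup_cocycle (repr x) (repr y)).

Lemma cup_classE p q k l (w : icocycle K R p k) (e : icocycle K R q l) :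
  cup_class (coclass w) (coclass e) = coclass (cup_cocycle w e).
Proof.
have repr_bound p' k' (x : icocycle K R p' k') :
    is_coboundary p' k' (ival (repr (coclass x) : icocycle K R p' k') - ival x).
  by apply/coclass_eqP; rewrite /coclass reprK.
rewrite /cup_class; set w' := repr (coclass w); set e' := repr (coclass e).
transitivity (coclass (cup_cocycle w e')); apply/coclass_eqP => /=.
  rewrite [X in is_coboundary _ _ X](_ : _ = family_cup (ival w' - ival w) (ival e')).
    apply: is_coboundary_cupl; [exact: repr_bound|exact: ivalP|exact: icocycle0].
  by rewrite family_cupBl.
rewrite [X in is_coboundary _ _ X](_ : _ = family_cup (ival w) (ival e' - ival e)).
  apply: is_coboundary_cupr; [exact: ivalP|exact: icocycle0|exact: repr_bound].
by rewrite family_cupBr.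
Qed.

Lemma coclass_val p k (w e : icocycle K R p k) : ival w = ival e -> coclass w = coclass e.
Proof. by move=> we; congr coclass; do 2![apply: val_inj]. Qed.

Fact one_cocycle_subproof :
  ICochain (@icochain_one K R X) \in @icocycle_pred K R X (perv0 X) 0.
Proof. by rewrite unfold_in; apply/eqP; exact: coboundary_family_one. Qed.

Definition one_class : cohomology K R (perv0 X) 0 :=
  coclass (ICocycle one_cocycle_subproof).

End CupProduct.

Theorem proposition4p2 (K : realType) (R : comPzRingType) (X : filteredSpace) :
  exists cup : forall (p q : perversity X) (k l : nat),
      icochain K R p k -> icochain K R q l ->
      icochain K R (pervD p q) (k + l)%N,
  [/\ (forall p q k l, bilinear_map (cup p q k l)),
      (forall p q k l (w : icochain K R p k) (e : icochain K R q l)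
              (m : nat) (s : regular_simplex K X m),
         ival (cup p q k l w e) m s = blow_cup (ival w m s) (ival e m s)),
      (forall p q r k l j (w : icochain K R p k) (e : icochain K R q l)
              (z : icochain K R r j),
         ival (cup p (pervD q r) k (l + j)%N w (cup q r l j e z)) =
         ival (cup (pervD p q) r (k + l)%N j (cup p q k l w e) z)) &
    exists cupH : forall (p q : perversity X) (k l : nat),
        cohomology K R p k -> cohomology K R q l ->
        cohomology K R (pervD p q) (k + l)%N,
    [/\ (forall p q k l, bilinear_map (cupH p q k l)),
        (forall p q k l (w : icocycle K R p k) (e : icocycle K R q l),
           exists2 z : icocycle K R (pervD p q) (k + l)%N,
             cval z = cup p q k l (cval w) (cval e) &
             cupH p q k l (coclass w) (coclass e) = coclass z),
        (forall p q r k l j (x : cohomology K R p k) (y : cohomology K R q l)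
                (z : cohomology K R r j),
           cast_cohomology (pervDA p q r) (addnA k l j)
             (cupH p (pervD q r) k (l + j)%N x (cupH q r l j y z)) =
           cupH (pervD p q) r (k + l)%N j (cupH p q k l x y) z),
        (forall p q k l (x : cohomology K R p k) (y : cohomology K R q l),
           cast_cohomology (pervDC p q) (addnC k l) (cupH p q k l x y) =
           (-1) ^+ (k * l) *: cupH q p l k y x) &
        exists one : cohomology K R (perv0 X) 0,
          forall p k (x : cohomology K R p k),
            cast_cohomology (perv0D p) (add0n k) (cupH _ _ _ _ one x) = x /\
            cast_cohomology (pervD0 p) (addn0 k) (cupH _ _ _ _ x one) = x]].
Proof.
exists (@cup_cochain K R X); split.
- move=> p q k l; split=> [w a e e'|e a w w']; apply: val_inj => /=.
    exact: family_cup_linearr.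
  exact: family_cup_linearl.
- by [].
- by move=> p q r k l j w e z; apply: Defs.familyP => m s; rewrite /= /family_cup blow_cupA.
exists (@cup_class K R X); split.
- move=> p q k l; split=> [x a y y'|y a x x'].
    have [[w ->] [[e ->] [e' ->]]] := (coclass_surj x, (coclass_surj y, coclass_surj y')).
    rewrite coclass_linear !cup_classE coclass_linear; apply: coclass_val.
    exact: family_cup_linearr.
  have [[e ->] [[w ->] [w' ->]]] := (coclass_surj y, (coclass_surj x, coclass_surj x')).
  rewrite coclass_linear !cup_classE coclass_linear; apply: coclass_val.
  exact: family_cup_linearl.
- by move=> p q k l w e; exists (cup_cocycle w e) => //; exact: cup_classE.
- move=> p q r k l j x y z.
  have [[w ->] [[e ->] [v ->]]] := (coclass_surj x, (coclass_surj y, coclass_surj z)).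
  rewrite !cup_classE; apply: coclass_cast; left; apply/eqP; rewrite subr_eq0.
  by apply/eqP/Defs.familyP => m s; rewrite /= /family_cup blow_cupA.
- move=> p q k l x y; have [[w ->] [e ->]] := (coclass_surj x, coclass_surj y).
  rewrite !cup_classE -[RHS]addr0.
  have -> : (0 : cohomology K R (pervD q p) (l + k)) = coclass 0.
    by apply: (@addrI _ (coclass 0)); rewrite -coclassD !addr0.
  rewrite coclass_linear addr0; apply: coclass_cast.
  by apply: is_coboundary_cupC; rewrite ?icocycle0 //; exact: ivalP.
exists (one_class K R X) => p k x; have [w ->] := coclass_surj x.
rewrite /one_class !cup_classE; split; apply: coclass_cast; left;
  apply/eqP; rewrite subr_eq0; apply/eqP/Defs.familyP => m s /=.
  exact: blow_cup_onel.
exact: blow_cup_oner.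
Qed.
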